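(* The $3$-uniform tight cycle $C_k^{(3)}$ is not Sidorenko for any $k\ge4$; the $3$-graph $C_k^{(3)}-e$ is not Sidorenko for any $k\ge7$; and $C_{2r}^{(r)}$ is not Sidorenko for any odd $r\ge3$.
   Context: An $r$-graph is a finite $r$-uniform hypergraph. For $\ell>r$, the tight cycle $C_\ell^{(r)}$ has vertex set $\{1,\dots,\ell\}$ and edges $\{i,i+1,\dots,i+r-1\}$ for $i=1,\dots,\ell$, with addition mod $\ell$. $C_\ell^{(r)}-e$ is obtained by deleting a single edge from $C_\ell^{(r)}$. For a symmetric measurable $W:[0,1]^r\to[0,1]$, $t_H(W)=\int_{[0,1]^{V(H)}}\prod_{\{u_1,\dots,u_r\}\in E(H)}W(x_{u_1},\dots,x_{u_r})\,dx$. $H$ is Sidorenko if $t_H(W)\ge(\int_{[0,1]^r}W)^{\mathrm{e}(H)}$ for every such $W$, where $\mathrm{e}(H)$ is the number of edges. *)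

(* Defs.v *)
From HB Require Import structures.
From mathcomp Require Import all_boot all_order all_algebra all_fingroup.
From mathcomp Require Import all_classical all_reals all_analysis.
From mathcomp Require Import zify.

Set Implicit Arguments.
Unset Strict Implicit.
Unset Printing Implicit Defensive.

Import Order.TTheory GRing.Theory Num.Theory.
Import numFieldNormedType.Exports.

Local Open Scope ring_scope.

Record uhypergraph (r : nat) := UHypergraph {
  vertices : finType;
  edges : {set {set vertices}};
  edges_uniform : forall e, e \in edges -> #|e| = r }.

Lemma delete_edge_uniform r (H : uhypergraph r) (e : {set vertices H}) :
  forall f, f \in edges H :\ e -> #|f| = r.
Proof. by move=> f /setD1P[_]; exact: edges_uniform. Qed.

Definition delete_edge r (H : uhypergraph r) (e : {set vertices H}) : uhypergraph r :=
  UHypergraph (delete_edge_uniform (e := e)).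

(* The vertices are 0, ..., l - 1 rather than 1, ..., l. *)
Definition tight_edge (r l : nat) (i : 'I_l) : {set 'I_l} :=
  [set u : 'I_l | [exists j : 'I_r, val u == (i + j) %% l]%N].

Lemma card_tight_edge (r l : nat) (i : 'I_l) : (r <= l)%N ->
  #|tight_edge r i| = r.
Proof.
move=> rl; have l0 : (0 < l)%N by case: l i {rl} => // -[].
pose f (j : 'I_r) : 'I_l := Ordinal (ltn_pmod (i + j) l0).
have fI : injective f.
  move=> j k [] /eqP; rewrite eqn_modDl !modn_small; last 2 first.
  - exact: leq_trans (ltn_ord k) rl.
  - exact: leq_trans (ltn_ord j) rl.
  by move=> /eqP/val_inj.
rewrite -[RHS]card_ord -(card_imset _ fI); apply: eq_card => u.
rewrite inE; apply/existsP/imsetP => [[j /eqP uE]|[j _ ->]].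
  by exists j => //; exact: val_inj.
by exists j.
Qed.

Lemma tight_cycle_uniform (r l : nat) : (r < l)%N ->
  forall e, e \in [set tight_edge r i | i : 'I_l] -> #|e| = r.
Proof. by move=> /ltnW rl e /imsetP[i _ ->]; exact: card_tight_edge. Qed.

Definition tight_cycle (r l : nat) (rl : (r < l)%N) : uhypergraph r :=
  UHypergraph (tight_cycle_uniform rl).

Lemma ltn_mul2 (r : nat) : (3 <= r)%N -> (r < 2 * r)%N.
Proof. by lia. Qed.

Local Open Scope classical_set_scope.

(* The n-fold product of a sigma-finite measure, on the product sigma-algebra
   of n.-tuple T. *)
Section tuple_measure.
Context d (T : measurableType d) (R : realType).

Definition cons_pair n (p : T * n.-tuple T) : n.+1.-tuple T :=
  [tuple of p.1 :: p.2].

Lemma measurable_cons_pair n : measurable_fun setT (@cons_pair n).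
Proof. by apply: measurable_cons. Qed.

Section cons_measure.
Context n (mu : {sigma_finite_measure set T -> \bar R})
  (nu : {sigma_finite_measure set (n.-tuple T) -> \bar R}).

Definition cons_measure : set (n.+1.-tuple T) -> \bar R :=
  pushforward (mu \x nu)%E (@cons_pair n).

Let cons_measure0 : cons_measure set0 = 0%E.
Proof. by rewrite /cons_measure /pushforward preimage_set0 measure0. Qed.

Let cons_measure_ge0 A : (0 <= cons_measure A)%E.
Proof. by rewrite /cons_measure /pushforward measure_ge0. Qed.

Let cons_measure_sigma_additive : semi_sigma_additive cons_measure.
Proof.
exact: (@measure_semi_sigma_additive _ _ _
  (measure_function_pushforward__canonical__measure_function_Measure
    (mu \x nu)%E (@measurable_cons_pair n))).
Qed.

HB.instance Definition _ := isMeasure.Build _ _ _ cons_measure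
  cons_measure0 cons_measure_ge0 cons_measure_sigma_additive.

Let cons_measure_sigma_finite : sigma_finite setT cons_measure.
Proof.
have [F FT Ffin] : sigma_finite setT (mu \x nu)%E.
  have /sigma_finiteP[F [TF ndF Foo]] := sigma_finiteT mu.
  have /sigma_finiteP[G [TG ndG Goo]] := sigma_finiteT nu.
  exists (fun i => F i `*` G i).
    rewrite -setXTT TF TG predeqE => -[x y]; split.
      move=> [/= [i _ Fix] [j _ Gjy]]; exists (maxn i j) => //; split.
      - by move: x Fix; exact/subsetPset/ndF/leq_maxl.
      - by move: y Gjy; exact/subsetPset/ndG/leq_maxr.
    by move=> [i _ []/= ? ?]; split; exists i.
  move=> i; have [? ?] := Foo i; have [? ?] := Goo i.
  split; first exact: measurableX.
  by rewrite product_measure1E// lte_mul_pinfty// ge0_fin_numE.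
pose uncons (t : n.+1.-tuple T) : T * n.-tuple T :=
  (thead t, [tuple of behead t]).
have munc : measurable_fun setT uncons.
  apply/measurable_fun_pairP; split; last exact: measurable_behead.
  exact: measurable_tnth.
have consK : cancel (@cons_pair n) uncons.
  by move=> [x t]; congr pair; exact: val_inj.
exists (fun i => uncons @^-1` F i).
  by rewrite -preimage_bigcup -FT preimage_setT.
move=> i; have [mF Foo] := Ffin i; split.
  by rewrite -[X in measurable X]setTI; exact: munc.
rewrite /cons_measure /pushforward -comp_preimage.
by rewrite (_ : uncons \o _ = id)//; apply/funext => p; exact: consK.
Qed.

HB.instance Definition _ := Measure_isSigmaFinite.Build _ _ _ cons_measure
  cons_measure_sigma_finite.

End cons_measure.

Fixpoint tuple_measure (mu : {sigma_finite_measure set T -> \bar R}) n :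
    {sigma_finite_measure set (n.-tuple T) -> \bar R} :=
  match n with
  | 0 => \d_([tuple] : 0.-tuple T)
  | m.+1 => cons_measure mu (tuple_measure mu m)
  end.

Lemma tuple_measure_box (mu : {sigma_finite_measure set T -> \bar R}) n
    (A : 'I_n -> set T) : (forall i, measurable (A i)) ->
  tuple_measure mu n [set t | forall i, A i (tnth t i)] =
  (\prod_(i < n) mu (A i))%E.
Proof.
elim: n A => [|n IH] A mA.
  by rewrite big_ord0 /= diracE mem_set// => -[].
rewrite big_ord_recl /= /cons_measure /pushforward.
rewrite -IH => [|i]; last exact: mA.
set B := [set t : n.-tuple T | _].
have mB : measurable B.
  rewrite (_ : B = \bigcap_(i in setT)
      ((fun t : n.-tuple T => tnth t i) @^-1` A (lift ord0 i))).
    apply: fin_bigcap_measurable => // i _; rewrite -[X in measurable X]setTI.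
    exact: measurable_tnth.
  by apply/seteqP; split => t /= h i; [move=> _; exact: h | exact: h].
rewrite -product_measure1E//; congr ((mu \x _)%E _).
apply/seteqP; split => -[x t] /=.
  move=> h; split; first exact: (h ord0).
  by move=> i; have := h (lift ord0 i); rewrite tnthS.
move=> [h0 h1] i; case: (unliftP ord0 i) => [j ->|->//].
by rewrite tnthS; exact: h1.
Qed.

End tuple_measure.

Section sidorenko.
Context (R : realType).

Local Notation mR := (measurableTypeR R).

Definition lebesgue_tuple n :
    {sigma_finite_measure set (n.-tuple mR) -> \bar R} :=
  tuple_measure lebesgue_measure n.

Definition unit_cube n : set (n.-tuple mR) :=
  [set x | forall i, 0 <= (tnth x i : R) <= 1].
Arguments unit_cube : clear implicits.

(* W is only evaluated on the unit cube; this describes a symmetric measurable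
   function from [0, 1]^r to [0, 1]. *)
Definition symmetric_kernel r (W : r.-tuple mR -> R) : Prop :=
  [/\ measurable_fun (unit_cube r) W,
      forall x, unit_cube r x -> 0 <= W x <= 1
    & forall (s : 'S_r) x, unit_cube r x ->
        W [tuple tnth x (s i) | i < r] = W x].

(* A point x of [0, 1]^V is stored as a #|V|-tuple, the coordinate of u : V
   having index enum_rank u. The vertices of an edge e are listed in the order
   of enum e, which is immaterial when W is symmetric; the default value of nth
   is never reached when #|e| = r. *)
Definition edge_point r (V : finType) (e : {set V}) (x : #|V|.-tuple mR) :
    r.-tuple mR :=
  [tuple [seq tnth x (enum_rank u) | u <- enum e]`_i | i < r].

Definition hom_density r (H : uhypergraph r) (W : r.-tuple mR -> R) : R :=
  \int[lebesgue_tuple #|vertices H|]_(x in unit_cube #|vertices H|)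
    \prod_(e in edges H) W (edge_point r e x).

Definition sidorenko r (H : uhypergraph r) : Prop :=
  forall W : r.-tuple mR -> R, symmetric_kernel W ->
    (\int[lebesgue_tuple r]_(x in unit_cube r) W x) ^+ #|edges H|
      <= hom_density H W.

End sidorenko.

Arguments unit_cube : clear implicits.

(* Main.v *)
Require Import Defs.
From mathcomp Require Import all_boot all_order all_algebra.
From mathcomp Require Import all_classical all_reals all_analysis.
From mathcomp Require Import all_fingroup measurable_realfun.
From mathcomp Require Import zify ring lra.

(* Let g be 1 on a rare set of measure p = m / (1 + m) and - m elsewhere, so that
   E g = 0 while E g^d = p (1 - (- m)^(d - 1)) for d >= 1.  For the kernel
   W = (1 - c prod_i g(x_i)) / 2 of density 1/2, expanding the product over the
   edges kills every nonempty set S of edges leaving a vertex of degree 1, and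
   2^e t_H(W) = 1 + p^|V| X(m) where, as m tends to 0, X(m) tends to the sum of
   (- c)^|S| over the sets S of edges giving every vertex degree at least 2.  So H
   is not Sidorenko as soon as this sum is negative for some c in (0, 1].
   - For C_k^(3) and C_k^(3) - e with k = 3n the sum obeys the linear recurrence
     L(j + 3) = - c L(j + 2) + c^2 L(j); with c of order 1 / n^3, degree 2 Taylor
     bounds in c show that it is negative.
   - For C_2r^(r) the sets S have at least 4 elements. There are at most r (r - 1) / 2
     of size 4 (unions of two antipodal pairs) and at least
     r (r - 1) (r - 2) (r + 1) (r + 12) / 60 of size 5; these two terms dominate for
     c = 60 / ((r - 2) (r + 1) (r + 12)), bounding the sets of even size s >= 6 by
     'C(2r, s).
   When 3 does not divide k neither 3-graph is tripartite, and the kernel which is 1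
   on triples of points with distinct colours has positive density but no copy. *)

Set Implicit Arguments.
Unset Strict Implicit.
Unset Printing Implicit Defensive.

Import Order.TTheory GRing.Theory Num.Theory.
Import numFieldNormedType.Exports.

Local Open Scope ring_scope.

(** * Integrals of step kernels *)

Section step_kernels.
Context (R : realType) (I : finType) (col : R -> I).

Local Notation mR := (measurableTypeR R).

Definition cell (i : I) : set mR := [set y : mR | 0 <= (y : R) <= 1 /\ col y = i]%classic.

Definition colors n (x : n.-tuple mR) : {ffun 'I_n -> I} :=
  [ffun j => col (tnth x j)].

Definition box n (f : {ffun 'I_n -> I}) : set (n.-tuple mR) :=
  [set x | forall j, cell (f j) (tnth x j)]%classic.

Hypothesis mcell : forall i, measurable (cell i).

Lemma measurable_box n (f : {ffun 'I_n -> I}) : measurable (box f).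
Proof.
rewrite (_ : box f = \bigcap_(j in setT)
    ((fun x : n.-tuple mR => tnth x j) @^-1` cell (f j)))%classic.
  apply: fin_bigcap_measurable => // j _; rewrite -[X in measurable X]setTI.
  exact: measurable_tnth.
by apply/seteqP; split => x /= h j; [move=> _; exact: h | exact: h].
Qed.

Lemma box_colors n (f : {ffun 'I_n -> I}) x :
  box f x <-> unit_cube R n x /\ colors x = f.
Proof.
split=> [h|[h <-] j]; last by split; [exact: h | rewrite ffunE].
by split=> [j|]; [case: (h j) | apply/ffunP => j; rewrite ffunE; case: (h j)].
Qed.

(** The boxes partition the cube, so a function of the colours, extended by 0, is a finite
    combination of indicators. Measurability and the integral both follow from this form. *)
Lemma step_restrict n (F : {ffun 'I_n -> I} -> R) :
  (F \o @colors n) \_ (unit_cube R n) =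
  (fun x => \sum_(f : {ffun 'I_n -> I}) F f * \1_(box f) x).
Proof.
apply/funext => x; rewrite patchE; case: ifPn => [/set_mem cx|ncx].
  rewrite (bigD1 (colors x)) //= indicE mem_set ?mulr1; last exact/box_colors.
  rewrite big1 ?addr0 // => f fx; rewrite indicE memNset ?mulr0 // => /box_colors[_ xf].
  by rewrite xf eqxx in fx.
rewrite big1 // => f _; rewrite indicE memNset ?mulr0 // => /box_colors[cx _].
by rewrite mem_set in ncx.
Qed.

Lemma measurable_step_sum n (F : {ffun 'I_n -> I} -> R) :
  measurable_fun setT
    (fun x => \sum_(f : {ffun 'I_n -> I}) F f * \1_(box f) x).
Proof.
apply: measurable_sum => f; apply: measurable_funM; first exact: measurable_cst.
by apply: measurable_indic; exact: measurable_box.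
Qed.

Lemma measurable_unit_cube n : measurable (unit_cube R n).
Proof.
rewrite (_ : unit_cube R n = \bigcup_(f in [set: {ffun 'I_n -> I}]) box f)%classic.
  apply: fin_bigcup_measurable => [|f _]; first exact: finite_finset.
  exact: measurable_box.
apply/seteqP; split => x /=; last by case=> f _ /box_colors[].
by move=> cx; exists (colors x) => //; exact/box_colors.
Qed.

Lemma measurable_step n (F : {ffun 'I_n -> I} -> R) :
  measurable_fun (unit_cube R n) (F \o @colors n).
Proof.
have := measurable_step_sum F; rewrite -step_restrict => mF.
exact: (measurable_restrictT _ (@measurable_unit_cube n)).2 mF.
Qed.

Variable p : I -> R.
Hypothesis pcell : forall i, lebesgue_measure (cell i) = (p i)%:E.

(** A box is a product of cells, so its measure is the product of their lengths, and linearity does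
    the rest. Integrals over the cube thus become finite sums over colourings. *)
Lemma integral_step n (F : {ffun 'I_n -> I} -> R) :
  \int[lebesgue_tuple R n]_(x in unit_cube R n) F (colors x) =
  \sum_(f : {ffun 'I_n -> I}) (\prod_j p (f j)) * F f.
Proof.
transitivity (\int[lebesgue_tuple R n]_x
    (\sum_(f : {ffun 'I_n -> I}) F f * \1_(box f) x)).
  by rewrite Rintegral_mkcond -step_restrict.
have mubox f : lebesgue_tuple R n (box f) = (\prod_j p (f j))%:E.
  rewrite -prodEFin; under eq_bigr do rewrite -pcell.
  exact: (tuple_measure_box lebesgue_measure (fun j => mcell (f j))).
have ibox f : (lebesgue_tuple R n).-integrable setT (fun x => (\1_(box f) x)%:E).
  apply/integrableP; split.
    apply/measurable_EFinP; apply: measurable_indic; exact: measurable_box.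
  rewrite (eq_integral (fun x => (\1_(box f) x)%:E)) => [|x _]; last first.
    by rewrite gee0_abs// lee_fin.
  rewrite (integral_indic _ measurableT (measurable_box f)) setIT.
  apply: (@le_lt_trans _ _ (\prod_j p (f j))%:E); last exact: ltry.
  by rewrite -mubox.
rewrite /Rintegral.
under eq_integral do rewrite -sumEFin.
rewrite integral_sum => [|//|f]; last first.
  under eq_fun do rewrite EFinM.
  exact: (integrableZl measurableT (F f) (ibox f)).
transitivity (fine (\sum_(f : {ffun 'I_n -> I}) (\prod_j p (f j) * F f)%:E)%E).
  congr fine; apply: eq_bigr => f _.
  under eq_integral do rewrite EFinM.
  rewrite (integralZl measurableT (ibox f)).
  rewrite (integral_indic _ measurableT (measurable_box f)) setIT.
  by rewrite mulrC EFinM; congr (_ * _)%E; exact: mubox.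
by rewrite sumEFin.
Qed.

End step_kernels.

(** * A negative signed count of edge sets refutes the Sidorenko property *)

(** A product over the coordinates does not see the order of [enum e], and [#|e| = r] keeps the
    default value of the list lookup out of reach. *)
Lemma prod_edge_point (R : realType) r (V : finType) (e : {set V})
    (x : #|V|.-tuple (measurableTypeR R)) (G : R -> R) : #|e| = r ->
  \prod_(i < r) G (tnth (edge_point r e x) i) =
  \prod_(u in e) G (tnth x (enum_rank u)).
Proof.
move=> er; pose s : seq R := [seq tnth x (enum_rank u) | u <- enum e].
transitivity (\prod_(i < r) G s`_i).
  by apply: eq_bigr => i _; congr G; exact: tnth_mktuple.
have ss : size s = r by rewrite size_map -cardE.
rewrite -(big_mkord xpredT (fun i => G s`_i)) -{1}ss -(big_nth 0 xpredT).
by rewrite big_map big_enum.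
Qed.

(** Continuity at 0 in algebraic form: X(m) = X(0) + m Q(m) with Q bounded on [0, 1], so a negative
    X(0) would make X negative at some small m > 0. *)
Lemma poly_ge0_at0 (R : realFieldType) (X : {poly R}) :
  (forall m, 0 < m < 1 -> 0 <= X.[m]) -> 0 <= X.[0].
Proof.
move=> X0; rewrite leNgt; apply/negP => Xlt0.
have /factor_theorem[Q XQ] : root (X - X.[0]%:P) 0.
  by rewrite /root !hornerE subrr.
have XE m : X.[m] = X.[0] + Q.[m] * m.
  have := congr1 (fun p => p.[m]) XQ; rewrite !hornerE subr0 => <-; ring.
have [ub ubP] := poly_itv_bound Q 0 1.
(* The test point is m = - X(0) / d: it lies in (0, 1), and [|ub|] m < - X(0), so m Q(m) cannot
   compensate X(0). *)
pose d := `|ub| + 1 - X.[0].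
have d0 : 0 < d by rewrite /d; have := normr_ge0 ub; lra.
have m01 : 0 < - X.[0] / d < 1.
  rewrite divr_gt0 ?oppr_gt0 //= ltr_pdivrMr // mul1r /d.
  by have := normr_ge0 ub; lra.
have := X0 _ m01; rewrite XE; apply/negP; rewrite -ltNge.
have /andP[m0 m1] := m01.
have Qle : Q.[- X.[0] / d] <= `|ub|.
  apply: le_trans (ler_norm _) _; apply: le_trans (ler_norm ub).
  by apply: ubP; rewrite !ltW.
have : Q.[- X.[0] / d] * (- X.[0] / d) <= `|ub| * (- X.[0] / d).
  by rewrite ler_pM2r.
have : `|ub| * (- X.[0] / d) < - X.[0].
  rewrite mulrCA -[ltRHS]mulr1 ltr_pM2l ?oppr_gt0 // ltr_pdivrMr // mul1r /d.
  by lra.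
by move=> h1 h2; have := le_lt_trans h2 h1; lra.
Qed.

(** * A two-valued function of mean zero and its moments *)

Section threshold.
Context (R : realType) (m : R).
Hypothesis m01 : 0 < m < 1.

Definition rare (y : R) : bool := y < m / (1 + m).

Definition rare_prob (b : bool) : R := if b then m / (1 + m) else (1 + m)^-1.

Definition rare_val (b : bool) : R := if b then 1 else - m.

Let m0 : 0 < m. Proof. by case/andP: m01. Qed.
Let m1 : m < 1. Proof. by case/andP: m01. Qed.
Let p0 : 0 < m / (1 + m). Proof. by have h := m0; apply: divr_gt0 => //; lra. Qed.
Let p1 : m / (1 + m) < 1. Proof. by have h := m0; rewrite ltr_pdivrMr; lra. Qed.

Let cell_rare b : cell rare b =
  (if b then `[0, m / (1 + m)[ else `[m / (1 + m), 1])%classic.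
Proof.
apply/seteqP; split => y; rewrite /cell /rare /=; have := (m0, (p0, p1)); move=> [? [? ?]].
  move=> [/andP[y0 y1] <-]; case: ltP => h; rewrite /= in_itv /=; lra.
by case: b; rewrite /= in_itv /= => /andP[h1 h2]; split; lra.
Qed.

Lemma measurable_cell_rare b : measurable (cell rare b).
Proof. by rewrite cell_rare; case: b; exact: measurable_itv. Qed.

Lemma measure_cell_rare b : lebesgue_measure (cell rare b) = (rare_prob b)%:E.
Proof.
rewrite cell_rare; case: b; rewrite lebesgue_measure_itv /= lte_fin ?p0 ?p1.
  by rewrite -EFinB subr0.
rewrite -EFinB; congr EFin; have : 1 + m != 0 by have := m0; lra.
by move=> ?; field.
Qed.

Lemma rare_moment0 : \sum_b rare_prob b * rare_val b ^+ 0 = 1.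
Proof.
rewrite big_bool /= !expr0 !mulr1; have : 1 + m != 0 by have := m0; lra.
by move=> ?; field.
Qed.

(** The factor m / (1 + m) is the same for all positive orders: this is what lets p^|V| be pulled
    out of every term in which each vertex has positive degree. *)
Lemma rare_momentS d : \sum_b rare_prob b * rare_val b ^+ d.+1 =
  m / (1 + m) * (1 - (- m) ^+ d).
Proof.
rewrite big_bool /= expr1n exprS; have : 1 + m != 0 by have := m0; lra.
by move=> ?; field.
Qed.

Lemma rare_moment1 : \sum_b rare_prob b * rare_val b = 0.
Proof.
have h := rare_momentS 0; rewrite expr0 subrr mulr0 in h.
by rewrite -[RHS]h; apply: eq_bigr => b _; rewrite expr1.
Qed.

Lemma normr_rare_val b : `|rare_val b| <= 1.
Proof. by case: b; rewrite /rare_val ?normr1 // normrN gtr0_norm // ltW. Qed.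

End threshold.

(** * The kernel (1 - c prod g) / 2 and its homomorphism densities *)

Section bump_kernel.
Context (R : realType) (m c : R).
Hypotheses (m01 : 0 < m < 1) (c01 : 0 < c <= 1).

Local Notation mR := (measurableTypeR R).
Local Notation g := (rare_val m).
Local Notation p := (rare_prob m).

Definition bump r (x : r.-tuple mR) : R :=
  (1 - c * \prod_(i < r) g (rare m (tnth x i))) / 2.

Lemma bump_step r : @bump r =
  (fun f : {ffun 'I_r -> bool} => (1 - c * \prod_i g (f i)) / 2)
    \o @colors R bool (rare m) r.
Proof.
apply/funext => x; rewrite /bump /=; congr ((1 - c * _) / 2).
by apply: eq_bigr => i _; rewrite ffunE.
Qed.

Lemma bump_symmetric r : symmetric_kernel (@bump r).
Proof.
split=> [|x _|s x _].
- rewrite bump_step; apply: measurable_step => b.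
  exact: measurable_cell_rare.
- have : `|c * \prod_(i < r) g (rare m (tnth x i))| <= 1.
    rewrite normrM normr_prod -[leRHS]mulr1; have /andP[c0 c1] := c01.
    apply: ler_pM => //; first exact: prodr_ge0.
      by rewrite gtr0_norm.
    by apply: prodr_ile1 => i _; rewrite normr_ge0 normr_rare_val.
  by rewrite ler_norml /bump => /andP[h1 h2]; apply/andP; split; lra.
- rewrite /bump; congr ((1 - c * _) / 2).
  rewrite [RHS](reindex_inj (@perm_inj _ s)); apply: eq_bigr => i _.
  congr (g (rare m _)); exact: tnth_mktuple.
Qed.

Lemma bump_density r : (0 < r)%N ->
  \int[lebesgue_tuple R r]_(x in unit_cube R r) bump x = 2^-1.
Proof.
move=> r0.
transitivity (\sum_(f : {ffun 'I_r -> bool}) (\prod_j p (f j)) *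
    ((1 - c * \prod_i g (f i)) / 2)).
  rewrite bump_step.
  exact: (integral_step (measurable_cell_rare m01) (measure_cell_rare m01)).
under eq_bigr do rewrite mulrA mulrBr mulr1 mulrCA -big_split.
rewrite -mulr_suml sumrB -mulr_sumr.
rewrite -(bigA_distr_bigA (fun (i : 'I_r) b => p b)).
rewrite -(bigA_distr_bigA (fun (i : 'I_r) b => p b * g b)).
rewrite big1 => [|i _]; last first.
  by rewrite -[RHS](rare_moment0 m01); apply: eq_bigr => b _; rewrite expr0 mulr1.
rewrite [X in 1 - c * X](_ : _ = 0); first by rewrite mulr0 subr0 mul1r.
by apply/eqP/prodf_eq0; exists (Ordinal r0) => //; rewrite rare_moment1.
Qed.

(** Edges are indexed by a type [J], so that sets of edges of a cycle are subsets of ['I_k] and a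
    deleted edge is just an index outside a set [D]. *)
Definition degree (J V : finType) (E : J -> {set V}) (S : {set J}) (u : V) : nat :=
  #|[set j in S | u \in E j]|.

(** Expanding the product over the edges gives one term per set S of edges, in which g(x_u) occurs
    to the power deg_S(u). Independence of the coordinates then turns each term into a product of
    moments. *)
Lemma bump_hom_density r (H : uhypergraph r) (J : finType)
    (E : J -> {set vertices H}) (D : {set J}) :
  injective E -> edges H = E @: D ->
  hom_density H (@bump r) = (2^-1) ^+ #|edges H| *
    \sum_(S : {set J} | S \subset D) (- c) ^+ #|S| *
       \prod_u \sum_b p b * g b ^+ degree E S u.
Proof.
move=> Einj HE; rewrite /hom_density.
pose F (f : {ffun 'I_#|vertices H| -> bool}) : R :=
  \prod_(e in edges H) ((1 - c * \prod_(u in e) g (f (enum_rank u))) / 2).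
transitivity (\int[lebesgue_tuple R #|vertices H|]_(x in unit_cube R #|vertices H|)
    F (colors (rare m) x)).
  apply: eq_Rintegral => x _; apply: eq_bigr => e eH; rewrite /bump; congr ((1 - c * _) / 2).
  rewrite (prod_edge_point x (g \o rare m)) ?(edges_uniform eH) //.
  by apply: eq_bigr => u _; rewrite ffunE.
rewrite (integral_step (measurable_cell_rare m01) (measure_cell_rare m01)).
have FE f : F f = (2^-1) ^+ #|edges H| *
    \sum_(S : {set J} | S \subset D) (- c) ^+ #|S| *
       \prod_u g (f (enum_rank u)) ^+ degree E S u.
  rewrite /F big_split /= prodr_const mulrC; congr (_ * _).
  rewrite HE big_imset /=; last by move=> ? ? _ _; exact: Einj.
  pose y j := - c * \prod_(u in E j) g (f (enum_rank u)).
  (* Indices outside [D] get the factor 0 + 1, so the product can be expanded over all subsets of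
     [J], those not inside [D] contributing 0. *)
  transitivity (\prod_j ((if j \in D then y j else 0) + 1)).
    rewrite big_mkcond; apply: eq_bigr => j _; case: ifP => _; last by rewrite add0r.
    by rewrite /y mulNr addrC.
  rewrite bigA_distr [RHS]big_mkcond /=; apply: eq_bigr => S _.
  case: ifP => [SD|/negbT/subsetPn[j jS jD]]; last first.
    by apply/eqP/prodf_eq0; exists j => //; rewrite jS (negPf jD).
  rewrite -big_mkcond /= (eq_bigr y) => [|j jS]; last by rewrite (fintype.subsetP SD).
  rewrite big_split /= prodr_const; congr (_ * _).
  rewrite (exchange_big_dep xpredT) //=; apply: eq_bigr => u _.
  by rewrite prodr_const; congr (_ ^+ _); apply: eq_card => j; rewrite inE.
under eq_bigr do rewrite FE mulrCA mulr_sumr.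
rewrite -mulr_sumr exchange_big /=; congr (_ * _); apply: eq_bigr => S SD.
under eq_bigr do rewrite mulrCA.
rewrite -mulr_sumr; congr (_ * _).
transitivity (\sum_(f : {ffun 'I_#|vertices H| -> bool}) \prod_u
    (p (f (enum_rank u)) * g (f (enum_rank u)) ^+ degree E S u)).
  apply: eq_bigr => f _; rewrite big_split /=; congr (_ * _).
  rewrite [LHS](reindex (@enum_rank (vertices H))) //.
  by exists enum_val => ? _; rewrite ?enum_rankK ?enum_valK.
rewrite (reindex (fun f : {ffun vertices H -> bool} =>
    [ffun i => f (enum_val i)])) /=; last first.
  exists (fun f => [ffun u => f (enum_rank u)]) => f _; apply/ffunP => i;
    by rewrite !ffunE ?enum_rankK ?enum_valK.
rewrite bigA_distr_bigA; apply: eq_bigr => f _; apply: eq_bigr => u _.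
by rewrite ffunE enum_rankK.
Qed.

End bump_kernel.

(** The condition on sets S rules out vertices of degree 0 once degree 1 is excluded; every
    surviving term then carries exactly p^|V|, and the remaining factor is a polynomial in m whose
    value at 0 is the given sum. *)
Lemma not_sidorenko_of_neg (R : realType) r (H : uhypergraph r) (J : finType)
    (E : J -> {set vertices H}) (D : {set J}) (c : R) :
  (0 < r)%N -> vertices H -> injective E -> edges H = E @: D ->
  (forall S : {set J}, S \subset D -> S != finset.set0 ->
     (forall u, degree E S u != 1%N) -> forall u, (2 <= degree E S u)%N) ->
  0 < c <= 1 ->
  \sum_(S : {set J} | (S \subset D) && [forall u, 2 <= degree E S u]%N)
     (- c) ^+ #|S| < 0 ->
  ~ sidorenko R H.
Proof.
move=> r0 v0 Einj HE ED c01 Plt0 sid.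
pose X : {poly R} :=
  \sum_(S : {set J} | (S \subset D) && [forall u, 2 <= degree E S u]%N)
     ((- c) ^+ #|S|)%:P * \prod_u (1 - (- 'X) ^+ (degree E S u).-1).
have XE m : X.[m] =
    \sum_(S : {set J} | (S \subset D) && [forall u, 2 <= degree E S u]%N)
     (- c) ^+ #|S| * \prod_u (1 - (- m) ^+ (degree E S u).-1).
  rewrite /X horner_sum; apply: eq_bigr => S _; rewrite hornerM hornerC horner_prod.
  by congr (_ * _); apply: eq_bigr => u _; rewrite !hornerE.
suff : 0 <= X.[0].
  rewrite XE; apply/negP; rewrite -ltNge; apply: le_lt_trans Plt0.
  rewrite le_eqVlt; apply/orP; left; apply/eqP; apply: eq_bigr => S /andP[_ /forallP dS].
  rewrite big1 ?mulr1 // => u _; rewrite oppr0 expr0n.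
  by have := dS u; case: (degree E S u) => [|[]]// n _; rewrite subr0.
apply: poly_ge0_at0 => m m01.
have /andP[m0 m1] := m01.
have := sid _ (@bump_symmetric R m c m01 c01 r); rewrite bump_density //.
rewrite (@bump_hom_density R m c m01 r H J E D Einj HE).
rewrite -[leLHS]mulr1 ler_pM2l ?exprn_gt0 ?invr_gt0 ?ltr0n //.
(* The empty set contributes 1, which matches the left-hand side after division by 2^-e; the
   nonempty sets must therefore have a non-negative total. *)
rewrite (bigD1 (finset.set0 : {set J})) ?finset.sub0set //= cards0 expr0 mul1r.
rewrite big1 => [|u _]; last first.
  rewrite (_ : degree E _ u = 0)%N ?rare_moment0 //.
  by apply: eq_card0 => j; rewrite !inE.
rewrite lerDl.
suff -> : \sum_(S : {set J} | (S \subset D) && (S != finset.set0))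
    (- c) ^+ #|S| * \prod_u \sum_b rare_prob m b * rare_val m b ^+ degree E S u =
    (m / (1 + m)) ^+ #|vertices H| * X.[m].
  rewrite pmulr_rge0 // exprn_gt0 // divr_gt0 //; lra.
rewrite XE mulr_sumr (bigID (fun S => [forall u, 2 <= degree E S u]%N)) /=.
rewrite [X in _ + X]big1 ?addr0; last first.
  move=> S /andP[/andP[SD S0] /forallPn[u du]].
  have [w dw] : exists w, degree E S w == 1%N.
    apply/existsP; apply: contraR du => /existsPn dS.
    by apply: ED => // w; exact: dS.
  apply/eqP; rewrite mulf_eq0; apply/orP; right; apply/prodf_eq0.
  exists w => //; rewrite (eqP dw).
  by under eq_bigr do rewrite expr1; rewrite rare_moment1.
apply: eq_big => [S|S /andP[_ /forallP dS]].
  rewrite -andbA; congr (_ && _); apply/andP/idP => [[]//|dS]; split=> //.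
  apply: contraL dS => /eqP ->; apply/forallPn; exists v0.
  rewrite (_ : degree E _ _ = 0)%N //; by apply: eq_card0 => j; rewrite !inE.
rewrite mulrCA; congr (_ * _).
rewrite -prodr_const (eq_bigl xpredT) // -big_split; apply: eq_bigr => u _ /=.
by have := dS u; case: (degree E S u) => // n _; rewrite rare_momentS.
Qed.

(** * Non-tripartite 3-graphs *)

Section thirds.
Context (R : realType).

Local Notation mR := (measurableTypeR R).

Definition third (y : R) : 'I_3 :=
  if y < 1 / 3 then inord 0 else if y < 2 / 3 then inord 1 else inord 2.

Let cell_third (i : 'I_3) : cell third i =
  (if val i == 0%N then `[0, 1 / 3[ else
   if val i == 1%N then `[1 / 3, 2 / 3[ else `[2 / 3, 1])%classic.
Proof.
have E j : (j < 3)%N -> val (inord j : 'I_3) = j by move=> ?; rewrite /= inordK.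
apply/seteqP; split => y; rewrite /cell /third /=.
  move=> [/andP[y0 y1] <-]; case: ltP => h; first by rewrite E //= in_itv /=; lra.
  by case: ltP => h'; rewrite E //= in_itv /=; lra.
case: i => -[|[|[|//]]] i3 /=; rewrite in_itv /= => /andP[h1 h2]; (split; first lra).
- by rewrite h2; apply: val_inj; rewrite E.
- by rewrite ltNge h1 h2 /=; apply: val_inj; rewrite E.
- have -> : (y < 1 / 3) = false by lra.
  by rewrite ltNge h1 /=; apply: val_inj; rewrite E.
Qed.

Lemma measurable_cell_third i : measurable (cell third i).
Proof.
by rewrite cell_third; case: ifP => _; last case: ifP => _; exact: measurable_itv.
Qed.

Lemma measure_cell_third i : lebesgue_measure (cell third i) = (3^-1)%:E.
Proof.
rewrite cell_third; case: ifP => _; last case: ifP => _;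
  rewrite lebesgue_measure_itv /= lte_fin; case: ltP => h; try (exfalso; lra);
  rewrite -EFinB; congr EFin; lra.
Qed.

Definition rainbow (x : 3.-tuple mR) : R := (injectiveb (colors third x))%:R.

Let F (f : {ffun 'I_3 -> 'I_3}) : R := (injectiveb f)%:R.

Lemma rainbow_symmetric : symmetric_kernel rainbow.
Proof.
split=> [|x _|s x _].
- exact: (measurable_step measurable_cell_third F).
- by rewrite /rainbow; case: injectiveb; rewrite ?lexx ?ler01.
- rewrite /rainbow; congr ((nat_of_bool _)%:R).
  have cE j : colors third [tuple tnth x (s i) | i < 3] j = colors third x (s j).
    by rewrite !ffunE; congr third; exact: tnth_mktuple.
  apply/injectiveP/injectiveP => inj i j.
    by have := inj ((s^-1)%g i) ((s^-1)%g j); rewrite !cE !permKV => h /h /perm_inj.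
  by rewrite !cE => /inj /perm_inj.
Qed.

Lemma rainbow_density_gt0 :
  0 < \int[lebesgue_tuple R 3]_(x in unit_cube R 3) rainbow x.
Proof.
have -> : \int[lebesgue_tuple R 3]_(x in unit_cube R 3) rainbow x =
    \sum_(f : {ffun 'I_3 -> 'I_3}) (\prod_(j < 3) 3^-1) * F f.
  exact: (integral_step measurable_cell_third measure_cell_third).
have p0 : 0 < \prod_(j < 3) 3^-1 :> R by apply: prodr_gt0 => j _; lra.
rewrite (bigD1 [ffun i => i]) //= ltr_pwDl //.
  rewrite mulr_gt0 // /F; have -> : injectiveb [ffun i : 'I_3 => i].
    by apply/injectiveP => i j; rewrite !ffunE.
  by rewrite ltr01.
by apply: sumr_ge0 => f _; apply: mulr_ge0; [exact: ltW|exact: ler0n].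
Qed.

(** Each point of the cube colours the vertices of [H] by thirds. Some edge is not rainbow, so the
    integrand vanishes identically while [rainbow] has positive density. *)
Lemma not_sidorenko_of_not_tripartite (H : uhypergraph 3) :
  (forall f : vertices H -> 'I_3, exists2 e, e \in edges H & ~ {in e &, injective f}) ->
  ~ sidorenko R H.
Proof.
move=> nf /(_ _ rainbow_symmetric); apply/negP; rewrite -ltNge.
have -> : hom_density H rainbow = 0; last by rewrite exprn_gt0 // rainbow_density_gt0.
transitivity (\int[lebesgue_tuple R #|vertices H|]_(x in
    unit_cube R #|vertices H|) (0 : R)); last by rewrite /Rintegral integral0.
apply: eq_Rintegral => x _; have [e eH ninj] := nf (fun u => third (tnth x (enum_rank u))).
apply/eqP/prodf_eq0; exists e => //; rewrite /rainbow pnatr_eq0 eqb0.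
apply/injectiveP => inj; apply: ninj => u v ue ve uv.
have e3 := edges_uniform eH.
have idx w : w \in e -> (index w (enum e) < 3)%N.
  by rewrite -mem_enum -index_mem -cardE e3.
have cE w (we : w \in e) : colors third (edge_point 3 e x) (Ordinal (idx w we)) =
    third (tnth x (enum_rank w)).
  rewrite ffunE; congr third.
  transitivity ([seq tnth x (enum_rank u) | u <- enum e]`_(index w (enum e))).
    exact: tnth_mktuple.
  by rewrite (nth_map w) ?nth_index ?mem_enum // index_mem mem_enum.
have := inj (Ordinal (idx u ue)) (Ordinal (idx v ve)); rewrite !cE => /(_ uv)[].
by move/(congr1 (nth u (enum e))); rewrite !nth_index ?mem_enum.
Qed.

End thirds.

(** * Vertices modulo k and 3-colourings of tight paths *)

Section cyclic_vertices.
Context (k : nat) (k0 : (0 < k)%N).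

Definition vtx (n : nat) : 'I_k := Ordinal (ltn_pmod n k0).

Lemma vtx_ord (i : 'I_k) : vtx i = i.
Proof. by apply: val_inj; rewrite /= modn_small. Qed.

Lemma vtx_modD n : vtx (n + k) = vtx n.
Proof. by apply: val_inj; rewrite /= modnDr. Qed.

Lemma eq_vtxD n i j : (i < k)%N -> (j < k)%N -> (vtx (n + i) == vtx (n + j)) = (i == j).
Proof. by move=> ik jk; rewrite -val_eqE /= eqn_modDl !modn_small. Qed.

Lemma mem_tight_edge r n j : (j < r)%N -> vtx (n + j) \in tight_edge r (vtx n).
Proof.
by move=> jr; rewrite inE; apply/existsP; exists (Ordinal jr); rewrite /= modnDml.
Qed.

Lemma tight_edgeP r (i u : 'I_k) :
  reflect (exists2 j, (j < r)%N & u = vtx (i + j)) (u \in tight_edge r i).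
Proof.
rewrite inE; apply: (iffP existsP) => [[j /eqP uE]|[j jr ->]].
  by exists j => //; apply: val_inj.
by exists (Ordinal jr).
Qed.

End cyclic_vertices.

(** The edge at [i0] is left aside so that both the cycle and the cycle minus an edge are covered.
    If all other edges were rainbow, three colours would force period 3 along the path, and closing
    up after k steps would give 3 | k. *)
Lemma tight_path_not_tripartite k (i0 : 'I_k) (f : 'I_k -> 'I_3) :
  (4 <= k)%N -> ~~ (3 %| k)%N ->
  exists2 i, i != i0 & ~ {in tight_edge 3 i &, injective f}.
Proof.
move=> k4 k3; apply: contrapT => nex.
have inj i : i != i0 -> {in tight_edge 3 i &, injective f}.
  by move=> ii0; apply: contrapT => ninj; apply: nex; exists i.
have k0 : (0 < k)%N by lia.
pose x j : nat := f (vtx k0 (i0.+1 + j)).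
have x3 j : (x j < 3)%N by exact: ltn_ord.
(* The path is read from i0 + 1, so offsets n < k - 1 run over all the starting points other than
   [i0]. *)
have xneq n a b : (n < k.-1)%N -> (a < 3)%N -> (b < 3)%N -> x (n + a)%N = x (n + b)%N -> a = b.
  move=> nk a3 b3 /val_inj; rewrite !addnA => /(inj (vtx k0 (i0.+1 + n))) h.
  apply/eqP; rewrite -(@eq_vtxD k k0 (i0.+1 + n)); try lia.
  apply/eqP/h; try exact: mem_tight_edge.
  have := @eq_vtxD k k0 i0 n.+1 0; rewrite addn0 vtx_ord addSnnS => -> //; lia.
have xS n : (n.+3 <= k)%N -> x n.+3 = x n.
  move=> nk; have := (x3 n, x3 n.+1, x3 n.+2, x3 n.+3).
  have h1 := @xneq n 0 1; have h2 := @xneq n 0 2; have h3 := @xneq n 1 2.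
  have g1 := @xneq n.+1 0 1; have g2 := @xneq n.+1 0 2; have g3 := @xneq n.+1 1 2.
  rewrite !addn0 !addn1 !addn2 in h1 h2 h3 g1 g2 g3.
  move=> [[[a0 a1] a2] a3].
  have {}h1 : x n <> x n.+1 by move=> e; have := h1 ltac:(lia) isT isT e.
  have {}h2 : x n <> x n.+2 by move=> e; have := h2 ltac:(lia) isT isT e.
  have {}h3 : x n.+1 <> x n.+2 by move=> e; have := h3 ltac:(lia) isT isT e.
  have {}g2 : x n.+1 <> x n.+3 by move=> e; have := g2 ltac:(lia) isT isT e.
  have {}g3 : x n.+2 <> x n.+3 by move=> e; have := g3 ltac:(lia) isT isT e.
  lia.
have xmod q s : (q * 3 + s <= k)%N -> x (q * 3 + s)%N = x s.
  elim: q => [|q IH] qk; first by rewrite add0n.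
  by rewrite (_ : q.+1 * 3 + s = (q * 3 + s).+3)%N ?xS ?IH //; lia.
have xk : x k = x 0 by rewrite /x addn0 vtx_modD.
have := xmod (k %/ 3)%N (k %% 3)%N; rewrite -divn_eq leqnn xk => /(_ isT) e.
have /eqP := @xneq 0 0 (k %% 3)%N ltac:(lia) isT (ltn_pmod k (isT : (0 < 3)%N)) e.
by rewrite eq_sym -/(3 %| k)%N (negPf k3).
Qed.

(** * Degrees in tight cycles *)

Section tight_degree.
Context (r k : nat) (k0 : (0 < k)%N).
Hypotheses (r0 : (0 < r)%N) (rk : (r < k)%N).

Local Notation v := (vtx k0).
Local Notation deg := (degree (@tight_edge r k)).

(** If equal edges had distinct starts i = j + a + 1 and j, the predecessor j + a of i would lie in
    the edge at i. Going round the cycle to reach it takes k - 1 >= r steps, too many for one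
    edge. *)
Lemma tight_edge_inj : injective (@tight_edge r k).
Proof.
move=> i j eij.
have : i \in tight_edge r j.
  by rewrite -eij; apply/(tight_edgeP k0); exists 0%N; rewrite ?addn0 ?vtx_ord.
case/(tight_edgeP k0) => -[|a] ar ia; first by rewrite ia addn0 vtx_ord.
have : v (j + a) \in tight_edge r i.
  by rewrite eij; apply/(tight_edgeP k0); exists a => //; lia.
case/(tight_edgeP k0) => b br; rewrite {}ia => e.
have {e}: v (j + a) = v (j + a + b.+1).
  by rewrite e; apply: val_inj; rewrite /= modnDml; congr (_ %% _)%N; lia.
by move=> /eqP; rewrite -{1}[(j + a)%N]addn0 eq_vtxD //; lia.
Qed.

(* The edges containing the vertex n + r - 1 are those starting at n, ..., n + r - 1. *)
Lemma tight_degree (S : {set 'I_k}) n :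
  deg S (v (n + r.-1)) = (\sum_(j < r) (v (n + j) \in S))%N.
Proof.
pose f (j : 'I_r) := v (n + j).
have fI : injective f.
  move=> a b /eqP; have := (ltn_ord a, ltn_ord b) => -[? ?].
  by rewrite eq_vtxD => [/eqP/val_inj||] //; lia.
rewrite -big_mkcond /= sum1dep_card -(card_imset _ fI) /degree; apply: eq_card => i.
rewrite inE; apply/andP/imsetP => [[iS /(tight_edgeP k0)[j jr e]]|[j jS ->]].
  have rj : (r.-1 - j < r)%N by lia.
  suff E : i = v (n + (r.-1 - j)).
    by exists (Ordinal rj); rewrite ?inE /f /= -E.
  have : v (n + (r.-1 - j) + j) = v (i + j) by rewrite -e -addnA subnK //; lia.
  move/(congr1 val) => /= /eqP; rewrite eqn_modDr => /eqP h.
  by rewrite -[LHS](vtx_ord k0); apply: val_inj; rewrite /= h.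
rewrite inE in jS; split=> //; apply/(tight_edgeP k0).
exists (r.-1 - j)%N; first by lia.
apply: val_inj; rewrite /= modnDml -addnA subnKC //.
by have := ltn_ord j; lia.
Qed.

(** Degrees become window sums, and the offset [o] allows the cycle to be read from any starting
    point. *)
Lemma forall_tight_degree (S : {set 'I_k}) o :
  [forall u, 2 <= deg S u]%N =
  [forall n : 'I_k, 2 <= \sum_(j < r) (v (o + n + j) \in S)]%N.
Proof.
apply/forallP/forallP => h n; first by rewrite -tight_degree.
(* The multiple k (o + r) keeps the truncated subtraction exact when solving for the window that
   ends at n. *)
have -> : n = v (o + (v (n + k * (o + r) - (o + r.-1))) + r.-1).
  apply: val_inj; rewrite /= -addnA addnCA modnDml.
  rewrite (_ : _ + (_ + _) = k * (o + r) + n)%N; last by have := leq_pmull (o + r) k0; lia.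
  by rewrite mulnC modnMDl modn_small.
by rewrite tight_degree; exact: h.
Qed.

(* Consecutive degrees differ by at most one, so a vanishing degree propagates
   around the cycle when no degree equals one. *)
Lemma tight_degree_ge2 (S : {set 'I_k}) : S != finset.set0 ->
  (forall u, deg S u != 1%N) -> forall u, (2 <= deg S u)%N.
Proof.
move=> /set0Pn[i iS] d1 u.
have [//|d0] := leqP 2 (deg S u).
have {}d0 : deg S (v u) = 0%N by rewrite vtx_ord; have := d1 u; lia.
(* An edge through n + 1 either starts there or also contains n. *)
have dS n : (deg S (v n.+1) <= (deg S (v n)).+1)%N.
  rewrite -[X in (_ <= X)%N]add1n.
  have b1 := leq_b1 (v n.+1 \notin [set j in S | v n \in tight_edge r j]).
  apply: leq_trans (leq_add b1 (leqnn _)).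
  rewrite -cardsU1; apply: subset_leq_card; apply/fintype.subsetP => j.
  rewrite inE in_setU1 => /andP[jS /(tight_edgeP k0)[[|a] ar e]].
    by rewrite e addn0 vtx_ord eqxx.
  apply/orP; right; rewrite inE jS; apply/(tight_edgeP k0); exists a; first exact: ltnW.
  apply: val_inj; move/(congr1 val): e => /= /eqP.
  by rewrite addnS -[n.+1]addn1 -[(j + a).+1]addn1 eqn_modDr => /eqP.
have dn n : deg S (v (u + n)) = 0%N.
  elim: n => [|n IH]; first by rewrite addn0.
  by have := dS (u + n)%N; rewrite -addnS IH; have := d1 (v (u + n.+1)); lia.
have := dn (i + (k - u))%N; rewrite addnCA subnKC ?vtx_modD ?vtx_ord; last exact: ltnW.
move/eqP; rewrite cards_eq0 => /eqP/finset.setP/(_ i); rewrite [RHS]inE inE iS /=.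
by move/negP; case; have := mem_tight_edge k0 i r0; rewrite addn0 !vtx_ord.
Qed.

End tight_degree.

(** * Tight cycles of 3-graphs *)

Section words.
Context (R : comNzRingType).

Definition sum_words n (F : seq bool -> R) : R := \sum_(t : n.-tuple bool) F t.

Lemma sum_words0 F : sum_words 0 F = F [::].
Proof.
rewrite /sum_words (bigD1 [tuple]) //= big1 ?addr0 // => t /eqP[].
by rewrite tuple0.
Qed.

Lemma sum_wordsS n F : sum_words n.+1 F =
  sum_words n (fun s => F (true :: s)) + sum_words n (fun s => F (false :: s)).
Proof.
rewrite /sum_words (reindex (fun bt : bool * n.-tuple bool => [tuple of bt.1 :: bt.2])) /=.
  by rewrite -(pair_bigA _ (fun b (t : n.-tuple bool) => F (b :: t))) big_bool.
exists (fun t => (thead t, [tuple of behead t])) => [[b t] _|t _] /=.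
  by congr pair; apply: val_inj.
by rewrite [RHS](tuple_eta t); apply: val_inj.
Qed.

Lemma sum_wordsSr n F : sum_words n.+1 F =
  sum_words n (fun s => F (rcons s true)) + sum_words n (fun s => F (rcons s false)).
Proof.
elim: n F => [|n IH] F; first by rewrite sum_wordsS !sum_words0.
by rewrite sum_wordsS 2!IH addrACA; congr (_ + _); rewrite sum_wordsS.
Qed.

Lemma eq_sum_words n F G : (forall s, size s = n -> F s = G s) ->
  sum_words n F = sum_words n G.
Proof. by move=> FG; apply: eq_bigr => t _; rewrite FG ?size_tuple. Qed.

Lemma sum_words_eq0 n F : (forall s, size s = n -> F s = 0) -> sum_words n F = 0.
Proof. by move=> F0; apply: big1 => t _; rewrite F0 ?size_tuple. Qed.

Lemma sum_wordsZ n a F : sum_words n (fun s => a * F s) = a * sum_words n F.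
Proof. by rewrite /sum_words mulr_sumr. Qed.

Lemma sum_words_set k (k0 : (0 < k)%N) o (F : {set 'I_k} -> R) (G : seq bool -> R) :
  (forall (S : {set 'I_k}) s, size s = k ->
     (forall i, (i < k)%N -> nth false s i = (vtx k0 (o + i) \in S)) -> F S = G s) ->
  \sum_S F S = sum_words k G.
Proof.
move=> FG; pose h (S : {set 'I_k}) := [tuple vtx k0 (o + i) \in S | i < k].
rewrite /sum_words (reindex h) /=.
  apply: eq_bigr => S _; apply: (FG S (h S)) => [|i ik]; first exact: size_tuple.
  by rewrite -(tnth_nth false (h S) (Ordinal ik)) tnth_mktuple.
have surj i : exists j : 'I_k, vtx k0 (o + j) = i.
  exists (vtx k0 (i + o * k - o)); apply: val_inj; rewrite /= modnDmr subnKC.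
    by rewrite addnC modnMDl modn_small.
  by rewrite -[leqLHS]muln1; apply: leq_trans (leq_addl _ _); rewrite leq_mul.
have hI : injective h.
  move=> S T hST; apply/finset.setP => i; have [j <-] := surj i.
  by have := congr1 (fun t => tnth t j) hST; rewrite !tnth_mktuple.
apply: onW_bij; apply: inj_card_bij => //.
by rewrite card_tuple card_bool -cardsT -powersetT card_powerset cardsT card_ord.
Qed.

(** Letters record which edges are chosen. The three edges through a vertex start at consecutive
    positions, so this is the condition that degrees are at least 2 along a path. *)
Fixpoint dense (s : seq bool) : bool :=
  match s with
  | a :: ((b :: d :: _) as t) => (2 <= a + b + d)%N && dense t
  | _ => true
  end.

Lemma denseP s : reflect (forall i, (i.+2 < size s)%N ->
  2 <= nth false s i + nth false s i.+1 + nth false s i.+2)%N (dense s).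
Proof.
elim: s => [|a [|b [|d s]] IH]; try by constructor => -[].
rewrite [dense _]/=; apply: (iffP andP) => [[h1 /IH h2] [|i] // /h2 //|h].
by split; [exact: (h 0%N)|apply/IH => i; exact: (h i.+1)].
Qed.

(** The condition involves three consecutive letters, so a word may be cut in two pieces overlapping
    in two letters. *)
Lemma dense_cat u a b s :
  dense (u ++ [:: a, b & s]) = dense (u ++ [:: a; b]) && dense [:: a, b & s].
Proof.
have denseS x t : dense (x :: t) =
    (if t is y :: z :: _ then 2 <= x + y + z else true)%N && dense t.
  by case: t => [|y [|z t]].
elim: u => [|x u IH] //; rewrite !cat_cons !(denseS x) IH andbA; congr (_ && _).
by congr (_ && _); case: u {IH} => [|y [|z u]].
Qed.

Variable c : R.

Definition wt (s : seq bool) : R := (- c) ^+ count id s.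

Lemma wt_cons b s : wt (b :: s) = (if b then - c else 1) * wt s.
Proof. by case: b; rewrite /wt /= ?mul1r // exprD expr1. Qed.

Lemma wt_rcons s b : wt (rcons s b) = wt s * (if b then - c else 1).
Proof. by rewrite /wt -cats1 count_cat exprD; case: b; rewrite /= ?expr0 ?expr1. Qed.

(* Padding with [true] on both sides imposes no condition beyond the one inside:
   any two letters [false] are at distance at least 3. *)
Definition lin n : R :=
  sum_words n (fun s => if dense ([:: true; true] ++ s ++ [:: true; true]) then wt s else 0).

Lemma lin0 : lin 0 = 1.
Proof. by rewrite /lin sum_words0 /wt expr0. Qed.

Lemma lin1 : lin 1 = 1 - c.
Proof. by rewrite /lin sum_wordsS !sum_words0 /= /wt /= expr1 expr0 addrC. Qed.

Lemma lin2 : lin 2 = - c * (2 - c).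
Proof.
by rewrite /lin !sum_wordsS !sum_words0 /= /wt /= !addn0 ?addn1 ?expr1; ring.
Qed.

Lemma linS n : lin n.+3 = - c * lin n.+2 + c ^+ 2 * lin n.
Proof.
rewrite {1}/lin sum_wordsS; congr (_ + _).
  rewrite /lin -sum_wordsZ; apply: eq_sum_words => s sn.
  rewrite (_ : dense _ = dense ([:: true; true] ++ s ++ [:: true; true])) //.
  by case: ifP => _; rewrite ?mulr0 // wt_cons.
rewrite 2!sum_wordsS [X in _ + X]sum_words_eq0 ?addr0; last first.
  by move=> s sn; case: s sn => [|x s].
rewrite [X in _ + X]sum_words_eq0 ?addr0; last by move=> s sn.
rewrite /lin -sum_wordsZ; apply: eq_sum_words => s sn.
rewrite (_ : dense _ = dense ([:: true; true] ++ s ++ [:: true; true])) //.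
by case: ifP => _; rewrite ?mulr0 // !wt_cons; ring.
Qed.

(* A cyclic word is dense iff the word followed by its first two letters is. *)
Definition cyc n : R :=
  sum_words n (fun s => if dense (s ++ take 2 s) then wt s else 0).

(** Read from the deleted edge, these words are the admissible sets of edges of the cycle minus that
    edge. *)
Definition cyc_false n : R :=
  sum_words n (fun s => if ~~ head true s && dense (s ++ take 2 s) then wt s else 0).

Let dense_lin s (w : seq bool) :
  dense s = dense ([:: true; true] ++ w ++ [:: true; true]) ->
  forall a, (if dense s then a * wt w else 0) =
    a * (if dense ([:: true; true] ++ w ++ [:: true; true]) then wt w else 0).
Proof. by move=> -> a; case: ifP => //; rewrite mulr0. Qed.

(** The initial [false] forces two letters [true] on each side of it cyclically. They weigh c^4 and
    pad the n remaining letters. *)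
Lemma cyc_falseE n : cyc_false n.+3.+2 = c ^+ 4 * lin n.
Proof.
rewrite /cyc_false sum_wordsS [X in X + _]sum_words_eq0 // add0r.
rewrite sum_wordsS [X in _ + X]sum_words_eq0 ?addr0; last by case=> // -[] s.
rewrite sum_wordsS [X in _ + X]sum_words_eq0 ?addr0 //.
have E (s u : seq bool) : [:: false, true, true & s ++ u] ++
    take 2 [:: false, true, true & s ++ u] =
    [:: false, true, true & s] ++ u ++ [:: false; true].
  by rewrite /= -catA.
rewrite sum_wordsSr [X in _ + X]sum_words_eq0 ?addr0; last first.
  by move=> s sn; rewrite -cats1 E [_ ++ _]/= dense_cat !andbF.
rewrite sum_wordsSr [X in _ + X]sum_words_eq0 ?addr0; last first.
  by move=> s sn; rewrite -!cats1 -[in dense _]catA E dense_cat !andbF.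
rewrite /lin -sum_wordsZ; apply: eq_sum_words => s sn.
rewrite -[RHS](@dense_lin ([:: false, true, true & s] ++ [:: true; true; false; true])).
  rewrite -!cats1 -[in dense _]catA E /= !wt_cons !cats1 !wt_rcons.
  by congr (if _ then _ else _); ring.
by rewrite dense_cat andbT.
Qed.

(** At most one of the first three letters is [false]. Each of the three positions for it
    contributes c^4 [lin n], its four neighbours being forced; three letters [true] contribute - c^3
    times the sum over the other n + 2 letters. *)
Lemma cycE n : cyc n.+3.+2 = 3 * c ^+ 4 * lin n - c ^+ 3 * lin n.+2.
Proof.
have -> : cyc n.+3.+2 = sum_words n.+4 (fun s =>
    if dense ((true :: s) ++ take 2 (true :: s)) then wt (true :: s) else 0) +
    cyc_false n.+3.+2.
  rewrite /cyc sum_wordsS; congr (_ + _).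
  by rewrite /cyc_false [RHS]sum_wordsS [X in _ = X + _]sum_words_eq0 // add0r.
rewrite cyc_falseE 2!sum_wordsS.
have -> : sum_words n.+2 (fun s =>
    if dense ([:: true, true, true & s] ++ take 2 [:: true, true, true & s])
    then wt [:: true, true, true & s] else 0) = - c ^+ 3 * lin n.+2.
  rewrite /lin -sum_wordsZ; apply: eq_sum_words => s sn.
  rewrite -[RHS](@dense_lin ([:: true, true, true & s] ++ [:: true; true])) //.
  by rewrite !wt_cons; congr (if _ then _ else _); ring.
rewrite (sum_wordsS n.+1) [X in _ + (_ + X) + _]sum_words_eq0 ?addr0; last by case=> // -[] s.
rewrite (sum_wordsS n) [X in _ + (_ + X) + _]sum_words_eq0 ?addr0; last by [].
have -> : sum_words n (fun s =>
    if dense ([:: true, true, false, true, true & s] ++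
      take 2 [:: true, true, false, true, true & s])
    then wt [:: true, true, false, true, true & s] else 0) = c ^+ 4 * lin n.
  rewrite /lin -sum_wordsZ; apply: eq_sum_words => s sn.
  rewrite -[RHS](@dense_lin ([:: true, true, false, true, true & s] ++ [:: true; true])) //.
  by rewrite !wt_cons; congr (if _ then _ else _); ring.
rewrite (sum_wordsS n.+2) [X in _ + (_ + X) + _]sum_words_eq0 ?addr0; last by case=> // -[] s.
rewrite (sum_wordsS n.+1) [X in _ + (_ + X) + _]sum_words_eq0 ?addr0; last by [].
have E (s : seq bool) b : [:: true, false, true, true & rcons s b] ++
    take 2 [:: true, false, true, true & rcons s b] =
    [:: true, false, true, true & s] ++ [:: b; true; false].
  by rewrite -cats1 /= -catA.
rewrite (sum_wordsSr n) [X in _ + (_ + X) + _]sum_words_eq0 ?addr0; last first.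
  by move=> s sn; rewrite E dense_cat andbF.
have -> : sum_words n (fun s =>
    if dense ([:: true, false, true, true & rcons s true] ++
      take 2 [:: true, false, true, true & rcons s true])
    then wt [:: true, false, true, true & rcons s true] else 0) = c ^+ 4 * lin n.
  rewrite /lin -sum_wordsZ; apply: eq_sum_words => s sn.
  rewrite E -[RHS](@dense_lin ([:: true, false, true, true & s] ++ [:: true; true; false])).
    by rewrite !wt_cons wt_rcons; congr (if _ then _ else _); ring.
  by rewrite dense_cat andbT.
ring.
Qed.

End words.

(** * From sets of edges of the cycle to cyclic words *)

Section triple_cycle_sums.
Context (R : comNzRingType) (c : R) (k : nat) (k0 : (0 < k)%N).
Hypothesis k4 : (4 <= k)%N.

Local Notation good S := [forall u, 2 <= degree (@tight_edge 3 k) S u]%N.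

Let good_dense o (S : {set 'I_k}) s : size s = k ->
  (forall i, (i < k)%N -> nth false s i = (vtx k0 (o + i) \in S)) ->
  good S = dense (s ++ take 2 s).
Proof.
move=> sk sS; rewrite (forall_tight_degree k0 (isT : 0 < 3)%N k4 S o).
have st : size (s ++ take 2 s) = k.+2.
  by rewrite size_cat size_takel sk ?addn2 //; lia.
have nth_st i : (i < k.+2)%N -> nth false (s ++ take 2 s) i = (vtx k0 (o + i) \in S).
  move=> ik; rewrite nth_cat sk; case: ltnP => h; first exact: sS.
  rewrite nth_take ?sS; try lia.
  by rewrite -[in RHS](subnK h) addnA vtx_modD.
apply/forallP/denseP => h.
  rewrite st => i ik; rewrite !nth_st; try lia.
  have := h (Ordinal (ik : (i < k)%N)); rewrite !big_ord_recr big_ord0 /=.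
  by rewrite add0n addn0 addn1 addn2 !addnS.
move=> i; have := h i; rewrite st !ltnS ltn_ord => /(_ isT).
have ik := ltn_ord i; rewrite !nth_st; try lia.
by rewrite !big_ord_recr big_ord0 /= add0n addn0 addn1 addn2 !addnS.
Qed.

Let wtE o (S : {set 'I_k}) s : size s = k ->
  (forall i, (i < k)%N -> nth false s i = (vtx k0 (o + i) \in S)) ->
  wt c s = (- c) ^+ #|S|.
Proof.
move=> sk sS; rewrite /wt; congr (_ ^+ _).
rewrite -sum1_count (big_nth false) sk big_mkord.
rewrite -sum1_card [RHS](reindex (fun i : 'I_k => vtx k0 (o + i))) /=.
  by apply: eq_bigl => i; rewrite sS.
apply: onW_bij; apply: injF_bij => i j /eqP.
by rewrite eq_vtxD // => /eqP/val_inj.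
Qed.

Lemma sum_good_cyc : \sum_(S | good S) (- c) ^+ #|S| = cyc c k.
Proof.
rewrite big_mkcond; apply: (sum_words_set (k0 := k0) (o := 0)) => S s sk sS.
by rewrite (good_dense sk sS) (wtE sk sS).
Qed.

Lemma sum_good_cyc_false (i0 : 'I_k) :
  \sum_(S : {set 'I_k} | (S \subset ~: [set i0]%SET) && good S) (- c) ^+ #|S| =
  cyc_false c k.
Proof.
rewrite big_mkcond; apply: (sum_words_set (k0 := k0) (o := i0)) => S s sk sS.
rewrite (good_dense sk sS) (wtE sk sS); congr (if _ && _ then _ else _).
rewrite finset.subsetC finset.sub1set inE -[i0](vtx_ord k0) -[X in vtx _ X]addn0 -sS //.
by case: s sk {sS} => // e; have := k4; rewrite -e.
Qed.

End triple_cycle_sums.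

(** * Sign of the linear recurrence for a suitable c *)

Section lin_estimates.
Context (R : realFieldType) (c : R).
Hypothesis c0 : 0 < c.

(** With these normalisations the recurrence becomes a system of first differences, in which c
    multiplies a single term; at c = 0 the values would be (N + 1)(N + 2) / 2, 1 and N + 2. *)
Let al N := lin c (3 * N) / c ^+ (2 * N).
Let be N := lin c (3 * N).+1 / c ^+ (2 * N).
Let ga N := - (lin c (3 * N).+2 / c ^+ (2 * N).+1).

Let cN0 : c != 0. Proof. exact: lt0r_neq0. Qed.

Let lin3S N : lin c (3 * N.+1) = - c * lin c (3 * N).+2 + c ^+ 2 * lin c (3 * N).
Proof. by rewrite mulnS -linS. Qed.

Let expc2S N : c ^+ (2 * N.+1) = c ^+ 2 * c ^+ (2 * N).
Proof. by rewrite mulnS exprD. Qed.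

Let expcN0 N : c ^+ N != 0. Proof. exact: expf_neq0. Qed.

Let alS N : al N.+1 = al N + ga N.
Proof.
by rewrite /al /ga lin3S expc2S [c ^+ (2 * N).+1]exprS; field; rewrite cN0 expcN0.
Qed.

Let beS N : be N.+1 = be N - c * al N.+1.
Proof.
have -> : be N.+1 = (- c * lin c (3 * N.+1) + c ^+ 2 * lin c (3 * N).+1) / c ^+ (2 * N.+1).
  by congr (_ / _); rewrite mulnS; exact: (linS c (3 * N).+1).
by rewrite /al /be expc2S; field; rewrite cN0 expcN0.
Qed.

Let gaS N : ga N.+1 = ga N + be N.+1.
Proof.
have -> : ga N.+1 =
    - ((- c * lin c (3 * N.+1).+1 + c ^+ 2 * lin c (3 * N).+2) / c ^+ (2 * N.+1).+1).
  by congr (- (_ / _)); rewrite mulnS; exact: (linS c (3 * N).+2).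
rewrite /be /ga [c ^+ (2 * N).+1]exprS [c ^+ (2 * N.+1).+1]exprS expc2S.
by field; rewrite cN0 expcN0.
Qed.

(* The Taylor polynomials in [c] of al, be, ga alternately bound them above and
   below; their coefficients are binomials in [j], written as polynomials. *)
Let lin_bounds (M : nat) :
  c * ((M%:R + 1) * (M%:R + 4) * (M%:R + 5)) <= 60 ->
  forall j, (j <= M.+1)%N -> let x := j%:R : R in
  [/\ 0 <= al j, al j <= (x + 1) * (x + 2) / 2
        & (x + 1) * (x + 2) / 2 -
            c * (x * (x + 1) * (x + 2) * (x + 3) * (x + 4) / 120) <= al j] /\
  [/\ be j <= 1, 1 - c * ((x + 1) * (x + 2) * (x + 3) / 6) <= be j
        & be j <= 1 - c * ((x + 1) * (x + 2) * (x + 3) / 6) +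
            c ^+ 2 * (x * (x + 1) * (x + 2) * (x + 3) * (x + 4) * (x + 5) / 720)] /\
  (ga j <= x + 2 /\ x + 2 - c * ((x + 1) * (x + 2) * (x + 3) * (x + 4) / 24) <= ga j).
Proof.
move=> cM; have c_gt0 := c0; elim=> [_ x|j IH jM x].
  rewrite /x /al /be /ga muln0 lin0 lin1 lin2 expr0 !muln0 expr1.
  have -> : - (- c * (2 - c) / c) = 2 - c by field.
  rewrite /x mulr0n !mul0r !add0r !mulr0 !divr1.
  by do ![split]; lra.
have [[a0 a1 a2] [[b1 b2 b3] [g1 g2]]] := IH (ltnW jM).
have xE : x = j%:R + 1 by rewrite /x -natr1.
have j0 : 0 <= j%:R :> R by exact: ler0n.
have jM' : j%:R <= M%:R :> R by rewrite ler_nat.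
move: (j%:R : R) j0 jM' xE a1 a2 b2 b3 g1 g2 => y y0 yM -> a1 a2 b2 b3 g1 g2.
rewrite gaS beS alS.
have cA : c * ((y + 1) * (y + 4) * (y + 5)) <= 60.
  apply: le_trans cM; rewrite ler_pM2l //.
  by apply: ler_pM; rewrite ?mulr_ge0 //; try lra; apply: ler_pM; lra.
have lo : (y + 2) * (y + 3) / 2 -
    c * ((y + 1) * (y + 2) * (y + 3) * (y + 4) * (y + 5) / 120) <= al j + ga j by lra.
(* The lower bound factors, and the size condition on c says exactly that its last factor is
   non-negative at the largest index. *)
have pos : 0 <= al j + ga j.
  apply: le_trans lo.
  rewrite (_ : _ - _ = (y + 2) * (y + 3) / 120 *
    (60 - c * ((y + 1) * (y + 4) * (y + 5)))); last by field.
  by apply: mulr_ge0; [apply: mulr_ge0; [apply: mulr_ge0|]|]; lra.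
have up : al j + ga j <= (y + 2) * (y + 3) / 2 by lra.
have cup : c * (al j + ga j) <= c * ((y + 2) * (y + 3) / 2) by rewrite ler_pM2l.
have clo : c * ((y + 2) * (y + 3) / 2 -
    c * ((y + 1) * (y + 2) * (y + 3) * (y + 4) * (y + 5) / 120)) <=
    c * (al j + ga j) by rewrite ler_pM2l.
have cpos : 0 <= c * (al j + ga j) by apply: mulr_ge0 => //; exact: ltW.
move: (c * (al j + ga j)) cup clo cpos => z cup clo cpos.
by do ![split]; lra.
Qed.

(** The choice of c makes the linear term of the upper bound on [be M] equal to 2, while the
    quadratic term stays below 1; hence [be M] < 1 - 2 + 1 = 0. The non-negativity of [al] is still
    available one index further. *)
Lemma lin_sign (M : nat) : (0 < M)%N ->
  c * ((M%:R + 1) * (M%:R + 2) * (M%:R + 3)) = 12 ->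
  lin c (3 * M).+1 < 0 /\ 0 <= lin c (3 * M.+1).
Proof.
move=> M0 cM; have c_gt0 := c0; have x1 : 1 <= M%:R :> R by rewrite ler1n.
have cM' : c * ((M%:R + 1) * (M%:R + 4) * (M%:R + 5)) <= 60.
  have -> : 60 = 5 * (c * ((M%:R + 1) * (M%:R + 2) * (M%:R + 3))) by rewrite cM; ring.
  rewrite [leRHS]mulrCA ler_pM2l //.
  by move: (M%:R : R) x1 => x x1; nra.
split.
  have [_ [[_ _ h] _]] := lin_bounds cM' (leqnSn M).
  suff : be M < 0 by rewrite /be pmulr_llt0 // invr_gt0 exprn_gt0.
  apply: le_lt_trans h _.
  move: (M%:R : R) x1 cM => x x1 cM.
  have -> : c * ((x + 1) * (x + 2) * (x + 3) / 6) = 2.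
    by rewrite mulrA cM; field.
  have -> : c ^+ 2 * (x * (x + 1) * (x + 2) * (x + 3) * (x + 4) * (x + 5) / 720) =
      c * (x * (x + 4) * (x + 5)) / 60.
    transitivity (c * (c * ((x + 1) * (x + 2) * (x + 3))) * (x * (x + 4) * (x + 5)) / 720).
      by field.
    by rewrite cM; field.
  suff : c * (x * (x + 4) * (x + 5)) < 60 by lra.
  have -> : 60 = c * ((x + 1) * (x + 2) * (x + 3) * 5) by rewrite mulrA cM -natrM.
  by rewrite ltr_pM2l //; nra.
have [[h _ _] _] := lin_bounds cM' (leqnn M.+1).
by move: h; rewrite /al pmulr_lge0 // invr_gt0 exprn_gt0.
Qed.

End lin_estimates.

Lemma exists_lin_sign (R : realFieldType) (M : nat) : (0 < M)%N ->
  exists2 c : R, 0 < c <= 1 & lin c (3 * M).+1 < 0 /\ 0 <= lin c (3 * M.+1).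
Proof.
move=> M0; have x1 : 1 <= M%:R :> R by rewrite ler1n.
have p : 0 < (M%:R + 1) * (M%:R + 2) * (M%:R + 3) :> R by rewrite !mulr_gt0 //; lra.
have c0 : 0 < 12 / ((M%:R + 1) * (M%:R + 2) * (M%:R + 3)) :> R by rewrite divr_gt0.
exists (12 / ((M%:R + 1) * (M%:R + 2) * (M%:R + 3))).
  by rewrite c0 ler_pdivrMr // mul1r; move: (M%:R : R) x1 => x x1; nra.
by apply: lin_sign => //; rewrite divfK // gt_eqF.
Qed.

(** * Tight cycles on twice as many vertices as the uniformity *)

Section antipodal_windows.
Context (r : nat) (k0 : (0 < 2 * r)%N).
Hypothesis r3 : (3 <= r)%N.

Local Notation k := (2 * r)%N.
Local Notation v := (vtx k0).
Local Notation good S := [forall u, 2 <= degree (@tight_edge r k) S u]%N.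

Definition window (S : {set 'I_k}) n := (\sum_(j < r) (v (n + j) \in S))%N.

Lemma goodP o (S : {set 'I_k}) :
  reflect (forall n, (n < k)%N -> 2 <= window S (o + n))%N (good S).
Proof.
rewrite (forall_tight_degree k0 (_ : 0 < r)%N (_ : r < k)%N S o); try lia.
apply: (iffP forallP) => h n; last exact: h.
by move=> nk; exact: (h (Ordinal nk)).
Qed.

(** Two windows of length r starting at antipodal positions partition the cycle of length 2r. *)
Lemma windowD (S : {set 'I_k}) n : (window S n + window S (n + r))%N = #|S|.
Proof.
rewrite -sum1_card (reindex (fun i : 'I_k => v (n + i))) /=; last first.
  apply: onW_bij; apply: injF_bij => i j /eqP.
  by rewrite eq_vtxD // => /eqP/val_inj.
pose F j := nat_of_bool (v (n + j) \in S).
transitivity (\sum_(0 <= i < k) F i)%N; last by rewrite big_mkord [RHS]big_mkcond.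
rewrite (big_cat_nat (n := r)) ?leq_pmull //= big_mkord; congr (_ + _)%N.
rewrite -[X in \big[_/_]_(X <= _ < _) _]add0n big_addn.
rewrite (_ : k - r = r)%N ?big_mkord; last by lia.
by apply: eq_bigr => i _; rewrite /F -addnA [(r + i)%N]addnC.
Qed.

Lemma windowS (S : {set 'I_k}) n :
  (window S n.+1 + (v n \in S))%N = (window S n + (v (n + r) \in S))%N.
Proof.
rewrite /window -(big_ord_recr r (fun j => nat_of_bool (v (n + j) \in S))).
rewrite big_ord_recl addn0 addnC; congr (_ + _)%N.
by apply: eq_bigr => j _; rewrite /= addnS.
Qed.

Lemma card_good_ge4 (S : {set 'I_k}) : good S -> (4 <= #|S|)%N.
Proof.
move=> /(goodP 0) h; rewrite -(windowD S 0).
by have := leq_add (h 0%N ltac:(lia)) (h r ltac:(lia)).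
Qed.

(** When S has 4 elements every window contains exactly 2 of them. Sliding a window by one step
    shows that S is invariant under the antipodal map, so S is determined by its two elements in the
    first half. *)
Lemma card_good4 : (#|[set S : {set 'I_k} | good S && (#|S| == 4)]| <= 'C(r, 2))%N.
Proof.
pose low (S : {set 'I_k}) := [set j : 'I_r | v j \in S].
have win2 S n : good S && (#|S| == 4%N) -> window S n = 2%N.
  move=> /andP[gS /eqP S4]; have h m : (2 <= window S m)%N.
    have := goodP m S gS; move=> /(_ 0%N ltac:(lia)); by rewrite addn0.
  by have := windowD S n; have := h n; have := h (n + r)%N; rewrite S4; lia.
have perS S n : good S && (#|S| == 4%N) -> (v (n + r) \in S) = (v n \in S).
  by move=> gS; have := windowS S n; rewrite !win2 //; do 2!case: (v _ \in S).
have lowI : {in [set S : {set 'I_k} | good S && (#|S| == 4%N)] &, injective low}.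
  move=> S T; rewrite !inE => gS gT lST; apply/finset.setP => i.
  have mem j : (j < r)%N -> (v j \in S) = (v j \in T).
    by move=> jr; have := congr1 (fun A : {set 'I_r} => Ordinal jr \in A) lST; rewrite !inE.
  rewrite -[i](vtx_ord k0); have [ir|ri] := ltnP i r; first exact: mem.
  by rewrite -[X in v X](subnK ri) !perS // mem //; have := ltn_ord i; lia.
rewrite -(card_in_imset lowI) -[r in 'C(r, _)]card_ord -card_draws.
apply: subset_leq_card; apply/fintype.subsetP => A /imsetP[S]; rewrite !inE => gS ->.
rewrite -(win2 S 0%N gS) /window -big_mkcond /= sum1dep_card; apply/eqP.
by apply: eq_card => j; rewrite !inE.
Qed.

End antipodal_windows.

(** * Counting interleaved quintuples *)

Lemma sum_interval (n a b : nat) : (b < n)%N ->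
  (\sum_(i < n) ((a <= i) && (i <= b)))%N = (b.+1 - a)%N.
Proof.
suff E m : (\sum_(i < m) ((a <= i) && (i <= b)))%N = (minn m b.+1 - a)%N.
  by rewrite E => bn; rewrite (minn_idPr bn).
by elim: m => [|m IH]; rewrite ?big_ord0 ?big_ord_recr /= ?IH; lia.
Qed.

Section interleaved.
Context (r : nat).

Definition below (x : nat) (p : 'I_r * 'I_r) : bool := (p.1 <= p.2 <= x)%N && (p.1 < x)%N.
Definition above (x : nat) (p : 'I_r * 'I_r) : bool := (x <= p.1 <= p.2)%N && (x < p.2)%N.

(** Here q stands for (t3, ((t1, t2), (t4, t5))) with t1 <= t2 <= t3 <= t4 <= t5, t1 < t3 < t5 and
    t2 < t4. Grouping around t3 makes the count a sum over t3 of products, up to the correction for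
    t2 = t4. *)
Definition interleaved (q : 'I_r * (('I_r * 'I_r) * ('I_r * 'I_r))) : bool :=
  [&& below q.1 q.2.1, above q.1 q.2.2 & q.2.1.2 != q.2.2.1].

Lemma card_below (x : 'I_r) : (2 * \sum_p below x p)%N = (x * (x + 3))%N.
Proof.
rewrite -(pair_bigA _ (fun a b => nat_of_bool (below x (a, b)))) /below /=.
transitivity (2 * \sum_(a < r) (if a < x then x.+1 - a else 0))%N.
  congr (2 * _)%N; apply: eq_bigr => a _; rewrite -(@sum_interval r a x) //.
  case: ltnP => ax; first by apply: eq_bigr => b _; rewrite andbT.
  by apply: big1 => b _; rewrite andbF.
suff E n y : (2 * \sum_(a < n) (if a < y then y.+1 - a else 0))%N =
    (minn n y * (2 * y + 3 - minn n y))%N.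
  by rewrite E (minn_idPr (ltnW (ltn_ord x))); congr (_ * _)%N; lia.
elim: n => [|n IH]; first by rewrite big_ord0 min0n.
rewrite big_ord_recr mulnDr IH /=; case: ltnP => h; last first.
  by rewrite muln0 addn0 !(minn_idPr _) // ltnW.
rewrite !(minn_idPl _) ?(ltnW h) // -(subnK h).
move: (y - n.+1)%N => d.
rewrite (_ : (d + n.+1).+1 - n = d.+2)%N; last by lia.
rewrite (_ : 2 * (d + n.+1) + 3 - n = 2 * d + n + 5)%N; last by lia.
rewrite (_ : 2 * (d + n.+1) + 3 - n.+1 = 2 * d + n + 4)%N; last by lia.
lia.
Qed.

Lemma card_above (x : 'I_r) :
  (2 * \sum_p above x p)%N = ((r.-1 - x) * (r.-1 - x + 3))%N.
Proof.
rewrite -(pair_bigA _ (fun a b => nat_of_bool (above x (a, b)))) /above /= exchange_big /=.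
transitivity (2 * \sum_(b < r) (if x < b then b.+1 - x else 0))%N.
  congr (2 * _)%N; apply: eq_bigr => b _; rewrite -(@sum_interval r x b) //.
  case: ltnP => ax; first by apply: eq_bigr => a _; rewrite andbT.
  by apply: big1 => a _; rewrite andbF.
suff E n y : (2 * \sum_(b < n) (if y < b then b.+1 - y else 0))%N =
    ((n.-1 - y) * (n.-1 - y + 3))%N by exact: E.
elim: n => [|n IH]; first by rewrite big_ord0.
rewrite big_ord_recr [LHS]mulnDr /= IH; case: ltnP => h; last first.
  by rewrite (eqP (h : n - y == 0)%N) (_ : n.-1 - y = 0)%N //; lia.
rewrite -(subnK h); move: (n - y.+1)%N => d.
rewrite (_ : (d + y.+1).-1 - y = d)%N; last by lia.
rewrite (_ : (d + y.+1).+1 - y = d.+2)%N; last by lia.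
rewrite (_ : d + y.+1 - y = d.+1)%N; last by lia.
lia.
Qed.

(** Since t2 <= x <= t4, equality of t2 and t4 forces both to be x, leaving x choices for t1 and r -
    1 - x for t5. *)
Lemma card_meet (x : 'I_r) :
  (\sum_p \sum_q [&& below x p, above x q & p.2 == q.1])%N = (x * (r.-1 - x))%N.
Proof.
transitivity (\sum_(p : 'I_r * 'I_r) \sum_(q : 'I_r * 'I_r)
    ((p.1 < x) * (p.2 == x)) * ((q.1 == x) * (x < q.2)))%N.
  apply: eq_bigr => -[a b] _; apply: eq_bigr => -[a' b'] _; rewrite /below /above /=.
  by rewrite -!val_eqE /=; lia.
under eq_bigr do rewrite -big_distrr.
rewrite -big_distrl /=; congr (_ * _)%N.
  rewrite -(pair_bigA _ (fun a b : 'I_r => (a < x) * (b == x)))%N /=.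
  transitivity (\sum_(a < r) ((0 <= a) && (a < x)))%N.
    apply: eq_bigr => a _; rewrite -big_distrr /= (bigD1 x) //= eqxx big1 ?addn0 ?muln1 //.
    by move=> b /negPf ->.
  have := ltn_ord x; case: (val x) => [|y] yr; first by rewrite big1.
  by rewrite sum_interval ?subn0 //; exact: ltnW.
rewrite -(pair_bigA _ (fun a b : 'I_r => (a == x) * (x < b)))%N /= (bigD1 x) //=.
rewrite [X in (_ + X)%N]big1 ?addn0.
  transitivity (\sum_(b < r) ((x.+1 <= b) && (b <= r.-1)))%N.
    by apply: eq_bigr => b _; rewrite eqxx; have := ltn_ord b; lia.
  by rewrite sum_interval; have := ltn_ord x; lia.
by move=> a /negPf ->; rewrite big1.
Qed.

Lemma card_interleaved_sum : (4 * #|interleaved| + 4 * \sum_(x < r) x * (r.-1 - x))%N =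
  (\sum_(x < r) (x * (x + 3)) * ((r.-1 - x) * (r.-1 - x + 3)))%N.
Proof.
rewrite -sum1_card big_mkcond /=.
rewrite -(pair_bigA _ (fun x pq => if (x, pq) \in interleaved then 1 else 0))%N /=.
rewrite -mulnDr -big_split big_distrr /=; apply: eq_bigr => x _.
rewrite -card_meet -card_below -card_above.
rewrite -(pair_bigA _ (fun p q => if (x, (p, q)) \in interleaved then 1 else 0))%N /=.
rewrite -big_split mulnACA -[(2 * 2)%N]/4%N; congr (4 * _)%N.
rewrite big_distrl /=; apply: eq_bigr => p _.
rewrite -big_split big_distrr /=; apply: eq_bigr => q _.
rewrite -[_ \in _]/(interleaved (x, (p, q))) /interleaved /=.
by case: (below x p); case: (above x q); case: eqP.
Qed.

Lemma card_interleaved (R : realFieldType) : (0 < r)%N ->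
  120 * #|interleaved|%:R =
  r%:R * (r%:R - 1) * (r%:R - 2) * (r%:R + 1) * (r%:R + 12) :> R.
Proof.
move=> r0; have := congr1 (fun n => n%:R : R) card_interleaved_sum.
rewrite natrD !natrM !natr_sum.
have rE : r.-1%:R = r%:R - 1 :> R by rewrite -[in RHS](prednK r0) -natr1 addrK.
(* Y is kept independent of n for the induction and becomes r - 1 afterwards. The right-hand side
   collects the power sums of degrees 4, 3, 2 and 1. *)
have E n (Y : R) : \sum_(x < n) (x%:R * (x%:R + 3)) * ((Y - x%:R) * (Y - x%:R + 3)) -
    4 * \sum_(x < n) x%:R * (Y - x%:R) =
    n%:R * (n%:R - 1) * (2 * n%:R - 1) * (3 * n%:R ^+ 2 - 3 * n%:R - 1) / 30
    - 2 * Y * (n%:R * (n%:R - 1) / 2) ^+ 2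
    + (Y ^+ 2 - 3 * Y - 5) * (n%:R * (n%:R - 1) * (2 * n%:R - 1) / 6)
    + (3 * Y ^+ 2 + 5 * Y) * (n%:R * (n%:R - 1) / 2).
  elim: n => [|n IH]; first by rewrite !big_ord0 /=; field.
  rewrite !big_ord_recr /= [4 * (_ + _)]mulrDr opprD addrACA IH -[n.+1%:R]natr1.
  by move: (n%:R : R) => x; field.
have s1 : \sum_(x < r) (x * (r.-1 - x))%:R = \sum_(x < r) x%:R * (r.-1%:R - x%:R) :> R.
  by apply: eq_bigr => x _; rewrite natrM natrB //; have := ltn_ord x; lia.
have s2 : \sum_(x < r) (x * (x + 3) * ((r.-1 - x) * (r.-1 - x + 3)))%:R =
    \sum_(x < r) (x%:R * (x%:R + 3)) * ((r.-1%:R - x%:R) * (r.-1%:R - x%:R + 3)) :> R.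
  by apply: eq_bigr => x _; rewrite !natrM !natrD natrB //; have := ltn_ord x; lia.
rewrite s1 s2 => h.
have {h} : 4 * #|interleaved|%:R = _ - 4 * _ := canRL (addrK _) h.
rewrite E rE => h.
have -> : 120 * #|interleaved|%:R = 30 * (4 * #|interleaved|%:R) :> R by ring.
by rewrite h; move: (r%:R : R) => x; field.
Qed.

End interleaved.

(** * Admissible five-element sets from interleaved quintuples *)

Section good_five_sets.
Context (r : nat) (k0 : (0 < 2 * r)%N).
Hypothesis r3 : (3 <= r)%N.

Local Notation k := (2 * r)%N.
Local Notation v := (vtx k0).
Local Notation good S := [forall u, 2 <= degree (@tight_edge r k) S u]%N.
Local Notation quintuple := ('I_r * (('I_r * 'I_r) * ('I_r * 'I_r)))%type.

(* Positions t1, t3, t5 in the first half of the cycle and r + t2, r + t4 in the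
   second one, where t1 <= t2 <= t3 <= t4 <= t5 in [0, r). *)
Definition alternating_pos (q : quintuple) : seq nat :=
  [:: q.2.1.1 : nat; q.1 : nat; q.2.2.2 : nat; r + q.2.1.2; r + q.2.2.1]%N.

(** The boolean applies a half turn: it decides which half of the cycle receives three of the five
    positions. *)
Definition alternating (b : bool) (q : quintuple) : {set 'I_k} :=
  [set x in [seq v (b * r + y) | y <- alternating_pos q]].

Let pos_lt q y : y \in alternating_pos q -> (y < k)%N.
Proof.
case: q => t3 [[t1 t2] [t4 t5]]; rewrite /alternating_pos /= !inE.
have := ltn_ord t1; have := ltn_ord t2; have := ltn_ord t3; have := ltn_ord t4.
by have := ltn_ord t5; lia.
Qed.

Let mem_alternating (b : bool) q y : (y < k)%N ->
  (v (b * r + y) \in alternating b q) = (y \in alternating_pos q).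
Proof.
move=> yk; rewrite inE; apply/mapP/idP => [[z zq /eqP]|yq]; last by exists y.
by rewrite eq_vtxD // ?(pos_lt zq) // => /eqP ->.
Qed.

Let window_ge2 (S : {set 'I_k}) n y z : (n <= y)%N -> (y < z)%N -> (z < n + r)%N ->
  forall o, v (o + y) \in S -> v (o + z) \in S -> (2 <= window k0 S (o + n))%N.
Proof.
move=> ny yz zn o yS zS.
have iy : (y - n < r)%N by lia.
have iz : (z - n < r)%N by lia.
rewrite /window (bigD1 (Ordinal iy)) //= (bigD1 (Ordinal iz)) /=; last first.
  by rewrite -val_eqE /=; lia.
by rewrite -!addnA !subnKC ?yS ?zS //; lia.
Qed.

(** In the cyclic order t1, t3, t5, r + t2, r + t4, any three consecutive positions p < q < q'
    satisfy q' <= p + r. A window starting after p and no later than q therefore contains both q and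
    q'. *)
Lemma good_alternating b q : interleaved q -> good (alternating b q).
Proof.
move=> iq; apply/(goodP k0 r3 (b * r)) => n nk.
have pin y : y \in alternating_pos q -> v (b * r + y) \in alternating b q.
  by move=> yq; rewrite mem_alternating // (pos_lt yq).
have pin' y : y \in alternating_pos q -> v (b * r + (y + k)) \in alternating b q.
  by move=> yq; rewrite addnA vtx_modD; exact: pin.
move: q iq pin pin' => [t3 [[t1 t2] [t4 t5]]].
rewrite /interleaved /below /above -val_eqE /= => iq pin pin'.
have p1 : v (b * r + t1) \in alternating b (t3, ((t1, t2), (t4, t5))).
  by apply: pin; rewrite !inE eqxx.
have p3 : v (b * r + t3) \in alternating b (t3, ((t1, t2), (t4, t5))).
  by apply: pin; rewrite !inE eqxx orbT.
have p5 : v (b * r + t5) \in alternating b (t3, ((t1, t2), (t4, t5))).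
  by apply: pin; rewrite !inE eqxx !orbT.
have p2 : v (b * r + (r + t2)) \in alternating b (t3, ((t1, t2), (t4, t5))).
  by apply: pin; rewrite !inE eqxx !orbT.
have p4 : v (b * r + (r + t4)) \in alternating b (t3, ((t1, t2), (t4, t5))).
  by apply: pin; rewrite !inE eqxx !orbT.
have p1' : v (b * r + (t1 + k)) \in alternating b (t3, ((t1, t2), (t4, t5))).
  by apply: pin'; rewrite !inE eqxx.
have p3' : v (b * r + (t3 + k)) \in alternating b (t3, ((t1, t2), (t4, t5))).
  by apply: pin'; rewrite !inE eqxx orbT.
have l1 := ltn_ord t1; have l2 := ltn_ord t2; have l3 := ltn_ord t3.
have l4 := ltn_ord t4; have l5 := ltn_ord t5.
have [n1|n1] := leqP n t1.
  by apply: (window_ge2 _ _ _ p1 p3); lia.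
have [n3|n3] := leqP n t3.
  by apply: (window_ge2 _ _ _ p3 p5); lia.
have [n5|n5] := leqP n t5.
  by apply: (window_ge2 _ _ _ p5 p2); lia.
have [n2|n2] := leqP n (r + t2).
  by apply: (window_ge2 _ _ _ p2 p4); lia.
have [n4|n4] := leqP n (r + t4).
  by apply: (window_ge2 _ _ _ p4 p1'); lia.
by apply: (window_ge2 _ _ _ p1' p3'); lia.
Qed.

Lemma card_alternating b q : interleaved q -> #|alternating b q| = 5%N.
Proof.
move=> iq; rewrite cardsE; apply/card_uniqP; rewrite map_inj_in_uniq.
  move: q iq => [t3 [[t1 t2] [t4 t5]]]; rewrite /interleaved /below /above -val_eqE /=.
  by have := ltn_ord t1; have := ltn_ord t3; have := ltn_ord t5; rewrite !inE; lia.
by move=> y z /pos_lt yk /pos_lt zk /eqP; rewrite eq_vtxD // => /eqP.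
Qed.

Lemma alternating_inj :
  {in [pred bq : bool * quintuple | interleaved bq.2] &,
    injective (fun bq => alternating bq.1 bq.2)}.
Proof.
have lowE (b : bool) q (j : 'I_r) : (v (b * r + j) \in alternating b q) =
    [|| j == q.2.1.1, j == q.1 | j == q.2.2.2].
  rewrite mem_alternating; last by have := ltn_ord j; lia.
  case: q => t3 [[t1 t2] [t4 t5]]; rewrite /alternating_pos /= !inE -!val_eqE /=.
  by have := ltn_ord j; lia.
have highE (b : bool) q (j : 'I_r) : (v (~~ b * r + j) \in alternating b q) =
    (j == q.2.1.2) || (j == q.2.2.1).
  have -> : v (~~ b * r + j) = v (b * r + (r + j)).
    case: b; last by rewrite mul1n mul0n !add0n.
    by rewrite mul0n mul1n add0n addnA addnn -mul2n addnC vtx_modD.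
  rewrite mem_alternating; last by have := ltn_ord j; lia.
  case: q => t3 [[t1 t2] [t4 t5]]; rewrite /alternating_pos /= !inE -!val_eqE /=.
  by have := ltn_ord j; have := ltn_ord t1; have := ltn_ord t3; have := ltn_ord t5; lia.
move=> [b q] [b' q']; rewrite !inE /= => iq iq' e.
have inc3 (a1 a3 a5 b1 b3 b5 : nat) :
    (a1 < a3)%N -> (a3 < a5)%N -> (b1 < b3)%N -> (b3 < b5)%N ->
    [|| a1 == b1, a1 == b3 | a1 == b5] -> [|| a3 == b1, a3 == b3 | a3 == b5] ->
    [|| a5 == b1, a5 == b3 | a5 == b5] -> [/\ a1 = b1, a3 = b3 & a5 = b5].
  move=> ? ? ? ?; do 3![case/or3P => /eqP ?]; first [by exfalso; lia|by split].
have inc2 (a2 a4 b2 b4 : nat) : (a2 < a4)%N -> (b2 < b4)%N ->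
    (a2 == b2) || (a2 == b4) -> (a4 == b2) || (a4 == b4) -> a2 = b2 /\ a4 = b4.
  by move=> ? ?; do 2![case/orP => /eqP ?]; first [by exfalso; lia|by split].
have sorted3 p : @interleaved r p -> (p.2.1.1 < p.1)%N && (p.1 < p.2.2.2)%N.
  by rewrite /interleaved /below /above => /and3P[/andP[_ ->] /andP[_ ->]].
have sorted2 p : @interleaved r p -> (p.2.1.2 < p.2.2.1)%N.
  rewrite /interleaved /below /above -val_eqE /=.
  move=> /and3P[/andP[/andP[_ h1] _] /andP[/andP[h2 _] _] h3].
  by rewrite ltn_neqAle h3 (leq_trans h1 h2).
have /andP[q13 q35] := sorted3 _ iq; have /andP[q13' q35'] := sorted3 _ iq'.
have q24 := sorted2 _ iq; have q24' := sorted2 _ iq'.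
(* If the booleans differed, three distinct positions in one half would have to lie among two. If
   they agree, sorting the positions within each half recovers the quintuple. *)
have [bb|bb] := eqVneq b b'; last first.
  have {}bb : b' = ~~ b by case: b b' bb {e} => -[].
  have h j : [|| j == q.2.1.1, j == q.1 | j == q.2.2.2] ->
      (j == q'.2.1.2) || (j == q'.2.2.1).
    by rewrite -(lowE b) e -(highE b') bb negbK.
  have := h q.2.1.1; have := h q.1; have := h q.2.2.2; rewrite !eqxx ?orbT -!val_eqE /=.
  move=> /(_ isT) h5 /(_ isT) h3 /(_ isT) h1.
  exfalso; move: h1 h3 h5; do 3![case/orP => /eqP ?]; lia.
have h j : [|| j == q.2.1.1, j == q.1 | j == q.2.2.2] ->
    [|| j == q'.2.1.1, j == q'.1 | j == q'.2.2.2].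
  by rewrite -(lowE b) e -(lowE b') bb.
have h' j : (j == q.2.1.2) || (j == q.2.2.1) -> (j == q'.2.1.2) || (j == q'.2.2.1).
  by rewrite -(highE b) e -(highE b') bb.
have := h q.2.1.1; have := h q.1; have := h q.2.2.2; rewrite !eqxx ?orbT.
move=> /(_ isT) h5 /(_ isT) h3 /(_ isT) h1.
have := h' q.2.1.2; have := h' q.2.2.1; rewrite !eqxx ?orbT.
move=> /(_ isT) h4 /(_ isT) h2.
have [e1 e3 e5] := inc3 _ _ _ _ _ _ q13 q35 q13' q35' h1 h3 h5.
have [e2 e4] := inc2 _ _ _ _ q24 q24' h2 h4.
congr pair => //; move: q q' e1 e2 e3 e4 e5
  {e iq iq' q13 q35 q13' q35' q24 q24' h h' h1 h2 h3 h4 h5}.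
move=> [t3 [[t1 t2] [t4 t5]]] [s3 [[s1 s2] [s4 s5]]] /=.
by do 5![move/val_inj ->].
Qed.

Lemma card_good5 : (2 * #|@interleaved r| <=
  #|[set S : {set 'I_k} | good S && (#|S| == 5)]|)%N.
Proof.
have -> : (2 * #|@interleaved r|)%N =
    #|[set bq : bool * quintuple | interleaved bq.2]|.
  by rewrite -card_bool -cardX cardsE; apply: eq_card => -[b q]; rewrite !inE.
have altI : {in [set bq : bool * quintuple | interleaved bq.2] &,
    injective (fun bq => alternating bq.1 bq.2)}.
  by move=> x y; rewrite !inE => ix iy; exact: alternating_inj.
rewrite -(card_in_imset altI); apply: subset_leq_card.
apply/fintype.subsetP => S /imsetP[[b q]]; rewrite !inE /= => iq ->.
by rewrite good_alternating ?card_alternating.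
Qed.

End good_five_sets.

(** * Estimating the signed sum for C_2r^(r) *)

Lemma sum_card_sets (R : pzSemiRingType) (T : finType) N (F : nat -> R) : (#|T| < N)%N ->
  \sum_(S : {set T}) F #|S| = \sum_(s < N) F s *+ 'C(#|T|, s).
Proof.
move=> TN; transitivity (\sum_(S : {set T}) \sum_(s < N | #|S| == s) F s).
  apply: eq_bigr => S _; have SN : (#|S| < N)%N by apply: leq_ltn_trans (max_card _) TN.
  rewrite (bigD1 (Ordinal SN)) //= big1 ?addr0 // => s /andP[/eqP sS].
  by rewrite -val_eqE /= sS eqxx.
rewrite (exchange_big_dep xpredT) //=; apply: eq_bigr => s _.
by rewrite sumr_const -card_draws; congr (_ *+ _); apply: eq_card => S; rewrite !inE.
Qed.

Lemma sum_even_terms (R : nmodType) M (G : nat -> R) : (forall s, odd s -> G s = 0) ->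
  \sum_(s < 2 * M) G s = \sum_(i < M) G (2 * i)%N.
Proof.
move=> G0; elim: M => [|M IH]; first by rewrite !big_ord0.
rewrite [RHS]big_ord_recr /= -IH (_ : 2 * M.+1 = (2 * M).+2)%N; last by lia.
by rewrite !big_ord_recr /= (G0 (2 * M).+1) ?addr0 //= oddM.
Qed.

Section antipodal_estimate.
Context (R : realFieldType) (r : nat) (k0 : (0 < 2 * r)%N).
Hypothesis r3 : (3 <= r)%N.

Local Notation k := (2 * r)%N.
Local Notation good S := [forall u, 2 <= degree (@tight_edge r k) S u]%N.
Local Notation x := (r%:R : R).

Let x3 : 3 <= x. Proof. by rewrite ler_nat. Qed.

Let binS s : (s < k)%N -> s.+1%:R * 'C(k, s.+1)%:R = (2 * x - s%:R) * 'C(k, s)%:R :> R.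
Proof.
by move=> sk; rewrite -natrM mul_bin_left natrM natrB ?natrM // ltnW.
Qed.

Lemma bin6 : 720 * 'C(k, 6)%:R =
  2 * x * (2 * x - 1) * (2 * x - 2) * (2 * x - 3) * (2 * x - 4) * (2 * x - 5) :> R.
Proof.
have e1 := @binS 0 ltac:(lia); have e2 := @binS 1 ltac:(lia).
have e3 := @binS 2 ltac:(lia); have e4 := @binS 3 ltac:(lia).
have e5 := @binS 4 ltac:(lia); have e6 := @binS 5 ltac:(lia).
rewrite bin0 mul1r subr0 mulr1 in e1.
have -> : 720 * 'C(k, 6)%:R = 120 * (6 * 'C(k, 6)%:R) :> R by ring.
rewrite e6; have -> (y z : R) : 120 * (y * z) = 24 * y * (5 * z) by ring.
rewrite e5; have -> (y z t : R) : 24 * y * (z * t) = 6 * y * z * (4 * t) by ring.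
rewrite e4; have -> (y z t u : R) : 6 * y * z * (t * u) = 2 * y * z * t * (3 * u) by ring.
rewrite e3.
have -> (y z t u w : R) : 2 * y * z * t * (u * w) = y * z * t * u * (2 * w) by ring.
by rewrite e2 e1; ring.
Qed.

(** The ratio of the two binomials is (k - s)(k - s - 1) / ((s + 1)(s + 2)), and 56 = 7 * 8 is the
    least denominator for s >= 6. *)
Let bin_step s : (6 <= s)%N -> 56 * 'C(k, s.+2)%:R <= (2 * x) ^+ 2 * 'C(k, s)%:R :> R.
Proof.
move=> s6; rewrite -!natrM -natrX -natrM ler_nat.
apply: (@leq_trans (s.+1 * s.+2 * 'C(k, s.+2))).
  by rewrite leq_mul2r; apply/orP; right; apply: (@leq_mul 7 8); lia.
rewrite -mulnA mul_bin_left mulnCA mul_bin_left mulnA leq_mul2r.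
by apply/orP; right; rewrite expnS expn1; apply: leq_mul; apply: leq_subr.
Qed.

Variable c : R.
Hypothesis c01 : 0 < c <= 1.

Let c0 : 0 <= c. Proof. by case/andP: c01 => /ltW. Qed.

Lemma good_sum_le : \sum_(S : {set 'I_k} | good S) (- c) ^+ #|S| <=
  #|[set S : {set 'I_k} | good S && (#|S| == 4)]|%:R * c ^+ 4 -
  #|[set S : {set 'I_k} | good S && (#|S| == 5)]|%:R * c ^+ 5 +
  \sum_(i < r - 2) 'C(k, 6 + 2 * i)%:R * c ^+ (6 + 2 * i).
Proof.
(* Odd sizes from 7 on contribute at most 0; for even sizes from 6 to 2r all sets are counted,
   admissible or not. *)
pose F s : R := if (6 <= s)%N && ~~ odd s then c ^+ s else 0.
have -> : \sum_(i < r - 2) 'C(k, 6 + 2 * i)%:R * c ^+ (6 + 2 * i) =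
    \sum_(S : {set 'I_k}) F #|S|.
  rewrite (@sum_card_sets _ _ (2 * (3 + (r - 2)))) ?card_ord; last by lia.
  rewrite (@sum_even_terms _ (3 + (r - 2)) (fun s => F s *+ 'C(k, s))) => [|s os]; last first.
    by rewrite /F os andbF mul0rn.
  rewrite big_split_ord /= [X in _ = X + _]big1 ?add0r => [|i _]; last first.
    by rewrite /F; case: leqP; rewrite ?mul0rn //; have := ltn_ord i; lia.
  apply: eq_bigr => i _; rewrite mulnDr mulr_natl /F ifT //.
  by rewrite oddD oddM andbT; lia.
have E n : #|[set S : {set 'I_k} | good S && (#|S| == n)]|%:R * c ^+ n =
    \sum_(S : {set 'I_k}) (if good S && (#|S| == n) then c ^+ n else 0).
  rewrite -big_mkcond sumr_const mulr_natl; congr (_ *+ _).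
  by apply: eq_card => S; rewrite !inE.
rewrite !E -sumrB -big_split /= big_mkcond; apply: ler_sum => S _.
have F0 : 0 <= F #|S| by rewrite /F; case: ifP => // _; exact: exprn_ge0.
case: ifP => gS; last by rewrite subrr add0r.
have := card_good_ge4 k0 r3 gS; move: #|S| F0 => s F0 s4 /=.
have cs : 0 <= c ^+ s by exact: exprn_ge0.
case: (eqVneq s 4%N) => [->|s4'].
  by rewrite /F subr0 addr0 exprNn -signr_odd expr0 mul1r.
case: (eqVneq s 5%N) => [->|s5].
  by rewrite /F sub0r addr0 exprNn -signr_odd expr1 mulN1r.
rewrite subrr add0r /F exprNn -signr_odd.
have -> : (6 <= s)%N by lia.
by case: odd; rewrite /= ?expr1 ?expr0 ?mulN1r ?mul1r // oppr_le0.
Qed.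

(** Consecutive terms have ratio at most q, so the sum T satisfies T <= b_0 + q T. The bound is kept
    multiplied by 1 - q, whose positivity is obtained only after c is fixed. *)
Lemma even_tail_le :
  (1 - (2 * x * c) ^+ 2 / 56) * \sum_(i < r - 2) 'C(k, 6 + 2 * i)%:R * c ^+ (6 + 2 * i) <=
  'C(k, 6)%:R * c ^+ 6.
Proof.
set q := _ / 56; pose b i : R := 'C(k, 6 + 2 * i)%:R * c ^+ (6 + 2 * i).
have bS i : b i.+1 <= q * b i.
  rewrite /b (_ : 6 + 2 * i.+1 = (6 + 2 * i).+2)%N; last by lia.
  have := @bin_step (6 + 2 * i) ltac:(lia).
  have : 0 <= c ^+ (6 + 2 * i) by exact: exprn_ge0.
  move: (6 + 2 * i)%N => s; rewrite (exprS c s.+1) (exprS c s) /q.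
  move: (c ^+ s) ('C(_, _)%:R) ('C(_, _)%:R) => w z y cs yz.
  apply: (@le_trans _ _ ((2 * x) ^+ 2 * z * (c ^+ 2 * w / 56))); last first.
    by rewrite le_eqVlt; apply/orP; left; apply/eqP; field.
  rewrite (_ : y * _ = 56 * y * (c ^+ 2 * w / 56)); last by field.
  by apply: ler_wpM2r => //; rewrite !mulr_ge0 ?exprn_ge0.
have b0 i : 0 <= b i by rewrite mulr_ge0 ?exprn_ge0.
have sumb n : \sum_(i < n) b i <= b 0%N + q * \sum_(i < n) b i.
  case: n => [|n]; first by rewrite !big_ord0 mulr0 addr0.
  rewrite {1}big_ord_recl lerD2l big_ord_recr /= mulrDr mulr_sumr.
  apply: ler_wpDr; last by apply: ler_sum => i _; exact: bS.
  by rewrite mulr_ge0 // divr_ge0 ?exprn_ge0 // !mulr_ge0.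
by have := sumb (r - 2)%N; rewrite /b muln0 addn0 mulrBl mul1r; lra.
Qed.

End antipodal_estimate.

Lemma exists_good_sum_lt0 (R : realFieldType) r (k0 : (0 < 2 * r)%N) : (3 <= r)%N ->
  exists2 c : R, 0 < c <= 1 &
    \sum_(S : {set 'I_(2 * r)} | [forall u, 2 <= degree (@tight_edge r (2 * r)) S u]%N)
      (- c) ^+ #|S| < 0.
Proof.
move=> r3; have r0 : (0 < r)%N by exact: leq_trans r3.
set x : R := r%:R; have x3 : 3 <= x by rewrite ler_nat.
have x0 : 0 < x by lra.
have x1 : 0 < x - 1 by lra.
have x25 : [/\ 0 <= 2 * x - 1, 0 <= 2 * x - 2, 0 <= 2 * x - 3,
    0 <= 2 * x - 4 & 0 <= 2 * x - 5].
  by split; lra.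
have xx0 : 0 < x * (x - 1) / 2 by rewrite divr_gt0 ?mulr_gt0.
pose D := (x - 2) * (x + 1) * (x + 12).
have D60 : 60 <= D by rewrite /D; nra.
have D0 : 0 < D by lra.
have c01 : 0 < 60 / D <= 1 by rewrite divr_gt0 //= ler_pdivrMr // mul1r.
(* This c makes the size 5 term at least c^4 x (x - 1), twice the bound on the size 4 term. It
   remains to show that the even tail is below c^4 x (x - 1) / 2. *)
exists (60 / D) => //; set c := 60 / D.
have c0 : 0 < c by case/andP: c01.
apply: le_lt_trans (good_sum_le k0 r3 c01) _.
have h4 : #|[set S : {set 'I_(2 * r)} | [forall u, 2 <= degree (@tight_edge r (2 * r)) S u]%N
    && (#|S| == 4)]|%:R <= x * (x - 1) / 2.
  have -> : x * (x - 1) / 2 = 'C(r, 2)%:R.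
    have : (2 * 'C(r, 2) = r * r.-1)%N by rewrite mul_bin_left bin1 mulnC subn1.
    move/(congr1 (fun n => n%:R : R)); rewrite !natrM -subn1 natrB //.
    by move=> e; rewrite -e; field.
  by rewrite ler_nat; exact: card_good4.
have h5 : x * (x - 1) * D / 60 <= #|[set S : {set 'I_(2 * r)} |
    [forall u, 2 <= degree (@tight_edge r (2 * r)) S u]%N && (#|S| == 5)]|%:R.
  have := card_interleaved R r0; rewrite -/x => e.
  have := card_good5 k0 r3; rewrite -(ler_nat R) natrM; apply: le_trans.
  rewrite (_ : x * (x - 1) * D = 120 * #|@interleaved r|%:R); last by rewrite e /D; ring.
  by lra.
have := even_tail_le k0 r3 c01; have := bin6 R k0 r3; rewrite -/x /=.
move: (\sum_(i < r - 2) _) ('C(_, 6)%:R) h4 h5 => T C6.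
move: (#|_|%:R) (#|_|%:R) => n5 n4 h4 h5 e6 hT.
have cD : c * D = 60 by rewrite /c divfK // gt_eqF.
(* This is the tail estimate [q1] multiplied by D^2 and divided by x (x - 1) / 2, with c^2 D^2 =
   3600. Substituting x = n + 3 exhibits the difference as a sum of terms non-negative for n >=
   0. *)
have key : 80 * (x - 2) * (2 * x - 1) * (2 * x - 3) * (2 * x - 5) + 1800 / 7 * x ^+ 2 < D ^+ 2.
  rewrite -subr_gt0 /D; have [n n0 ->] : exists2 n, 0 <= n & x = n + 3.
    by exists (x - 3); [rewrite subr_ge0|rewrite subrK].
  rewrite (_ : _ - _ = 600 / 7 + 21400 / 7 * n + n ^+ 2 *
    (n ^+ 4 + 40 * (n * (n - 2) ^+ 2) + 78 * (n - 3) ^+ 2 +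
     (68 * n + 7853 / 7))); last by field.
  apply: ltr_pwDl; first by lra.
  have p4 : 0 <= n ^+ 4 by exact: exprn_ge0.
  have p2 : 0 <= n * (n - 2) ^+ 2 by rewrite mulr_ge0 ?sqr_ge0.
  have p3 : 0 <= (n - 3) ^+ 2 by exact: sqr_ge0.
  by apply: mulr_ge0; [exact: sqr_ge0|lra].
have cc : c ^+ 2 * D ^+ 2 = 3600 by rewrite -exprMn cD; ring.
have q1 : C6 * c ^+ 2 < (1 - (2 * x * c) ^+ 2 / 56) * (x * (x - 1) / 2).
  have DD : 0 < D ^+ 2 by rewrite exprn_gt0.
  rewrite -(ltr_pM2r DD) -[ltLHS]mulrA cc.
  have -> : (1 - (2 * x * c) ^+ 2 / 56) * (x * (x - 1) / 2) * D ^+ 2 =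
      (D ^+ 2 - x ^+ 2 * (c ^+ 2 * D ^+ 2) / 14) * (x * (x - 1) / 2) by field.
  rewrite cc; have -> : C6 * 3600 =
      80 * (x - 2) * (2 * x - 1) * (2 * x - 3) * (2 * x - 5) * (x * (x - 1) / 2).
    by rewrite (_ : C6 * 3600 = 5 * (720 * C6)); [rewrite e6; field|ring].
  by rewrite (ltr_pM2r xx0); move: key; clear; lra.
(* The left-hand side of [q1] is non-negative, so the factor 1 - q on its right is positive. *)
have q0 : 0 < 1 - (2 * x * c) ^+ 2 / 56.
  have C60 : 0 <= C6.
    have h720 : 0 < 720 :> R by rewrite ltr0n.
    rewrite -(pmulr_rge0 C6 h720) e6.
    by case: x25 => ? ? ? ? ?; rewrite !mulr_ge0 // ltW.
  rewrite -(pmulr_lgt0 _ xx0); apply: le_lt_trans q1.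
  by rewrite mulr_ge0 ?sqr_ge0.
have c4 : 0 < c ^+ 4 by exact: exprn_gt0.
have T4 : T < c ^+ 4 * (x * (x - 1) / 2).
  rewrite -(ltr_pM2l q0); apply: le_lt_trans hT _.
  rewrite (_ : C6 * c ^+ 6 = c ^+ 4 * (C6 * c ^+ 2)); last by ring.
  by rewrite [ltRHS]mulrCA ltr_pM2l.
have n5c : x * (x - 1) <= n5 * c.
  have : x * (x - 1) * D / 60 * c <= n5 * c by rewrite ler_pM2r.
  rewrite (_ : x * (x - 1) * D / 60 * c = x * (x - 1) * (c * D) / 60); last by field.
  by rewrite cD mulfK // pnatr_eq0.
have h : n4 * c ^+ 4 - n5 * c ^+ 5 <= - (c ^+ 4 * (x * (x - 1) / 2)).
  rewrite (_ : n4 * c ^+ 4 - n5 * c ^+ 5 = c ^+ 4 * (n4 - n5 * c)); last by ring.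
  rewrite -[leRHS]mulrN ler_pM2l //; move: h4 n5c; clear; lra.
by rewrite -(addNr (c ^+ 4 * (x * (x - 1) / 2))); exact: ler_ltD.
Qed.

(** * Non-Sidorenko tight cycles *)

(** Both sums are combinations of [lin] at 3n - 5 and 3n - 3; the signs found for these two values
    make every term non-positive and the first one negative. *)
Lemma exists_cyc_false_lt0 (R : realFieldType) n : (3 <= n)%N ->
  exists2 c : R, 0 < c <= 1 & cyc_false c (3 * n) < 0 /\ cyc c (3 * n) < 0.
Proof.
case: n => [|[|[|M]]] // _.
have [c c01 [be0 al0]] := exists_lin_sign R (ltn0Sn M).
exists c => //; have /andP[c0 _] := c01.
have F0 : c ^+ 4 * lin c (3 * M.+1).+1 < 0 by rewrite pmulr_rlt0 ?exprn_gt0.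
have L0 : 0 <= c ^+ 3 * lin c (3 * M.+2) by rewrite mulr_ge0 ?exprn_ge0 // ltW.
rewrite (_ : 3 * M.+3 = (3 * M.+1).+1.+3.+2)%N; last by lia.
rewrite cyc_falseE cycE (_ : (3 * M.+1).+3 = 3 * M.+2)%N; last by lia.
by split; lra.
Qed.

Lemma triple_cycle_not_sidorenko (R : realType) k (k_ge4 : (4 <= k)%N) :
  ~ sidorenko R (tight_cycle (r := 3) (l := k) k_ge4).
Proof.
have k0 : (0 < k)%N by lia.
have [k3|k3] := boolP (3 %| k)%N; last first.
  apply: not_sidorenko_of_not_tripartite => f.
  have [i _ ninj] := tight_path_not_tripartite (vtx k0 0) f k_ge4 k3.
  by exists (tight_edge 3 i) => //; apply/imsetP; exists i.
have [c c01 Plt0] : exists2 c : R, 0 < c <= 1 & cyc c k < 0.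
  have [n kn] : exists n, k = (3 * n)%N by exists (k %/ 3)%N; rewrite mulnC divnK.
  have [n3|n3] := leqP 3 n.
    by have [c ? []] := exists_cyc_false_lt0 R n3; rewrite kn; exists c.
  (* Only k = 6 is left; at c = 1 the sum is 3 * 0 - 2 = - 2. *)
  exists 1; first by rewrite ltr01 lexx.
  rewrite kn (_ : n = 2); last by lia.
  by rewrite (cycE _ 1) (linS _ 0) lin0 lin1 lin2; lra.
apply: (@not_sidorenko_of_neg R 3 (tight_cycle k_ge4) _ (@tight_edge 3 k)
  [set: 'I_k]%SET c) => //.
- exact: (vtx k0 0).
- exact: tight_edge_inj.
- by apply/finset.setP => e; apply/imsetP/imsetP => -[i _ ->]; exists i.
- by move=> S _ S0 dS u; apply: (tight_degree_ge2 k0).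
- under eq_bigl do rewrite finset.subsetT andTb.
  by rewrite (sum_good_cyc _ k0 k_ge4).
Qed.

Lemma triple_cycle_minus_edge_not_sidorenko (R : realType) k (k_ge4 : (4 <= k)%N)
    (e : {set 'I_k}) : (7 <= k)%N ->
  e \in edges (tight_cycle (r := 3) (l := k) k_ge4) ->
  ~ sidorenko R (delete_edge (H := tight_cycle (r := 3) (l := k) k_ge4) e).
Proof.
move=> k7 /imsetP[i0 _ ->].
have k0 : (0 < k)%N by lia.
have inj : injective (@tight_edge 3 k) by exact: tight_edge_inj.
have [k3|k3] := boolP (3 %| k)%N; last first.
  apply: not_sidorenko_of_not_tripartite => f.
  have [i ii0 ninj] := tight_path_not_tripartite i0 f k_ge4 k3.
  exists (tight_edge 3 i) => //; rewrite in_setD1 (inj_eq inj) ii0.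
  by apply/imsetP; exists i.
have [n kn] : exists n, k = (3 * n)%N by exists (k %/ 3)%N; rewrite mulnC divnK.
have n3 : (3 <= n)%N by lia.
have [c c01 [Plt0 _]] := exists_cyc_false_lt0 R n3; rewrite -kn in Plt0.
(* The edges are still indexed by ['I_k], with [i0] left out of [D], so the degree lemmas of the
   full cycle apply as they are. *)
apply: (@not_sidorenko_of_neg R 3 (delete_edge (H := tight_cycle k_ge4) _) _
  (@tight_edge 3 k) (~: [set i0])%SET c) => //.
- apply/finset.setP => f; rewrite in_setD1; apply/andP/imsetP => [[fi0 /imsetP[i _ fi]]|[i]].
    by exists i => //; rewrite !inE; apply: contraNN fi0 => /eqP <-; rewrite fi.
  by rewrite !inE => ii0 ->; rewrite (inj_eq inj); split => //; apply/imsetP; exists i.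
- by move=> S _ S0 dS u; apply: (tight_degree_ge2 k0).
- by rewrite (sum_good_cyc_false _ k0 k_ge4).
Qed.

Lemma tight_cycle_double_not_sidorenko (R : realType) r (r_ge3 : (3 <= r)%N) :
  ~ sidorenko R (tight_cycle (ltn_mul2 r_ge3)).
Proof.
have k0 : (0 < 2 * r)%N by lia.
have r0 : (0 < r)%N by exact: leq_trans r_ge3.
have rk := ltn_mul2 r_ge3.
have [c c01 Plt0] := exists_good_sum_lt0 R k0 r_ge3.
apply: (@not_sidorenko_of_neg R r (tight_cycle (ltn_mul2 r_ge3)) _
  (@tight_edge r (2 * r)) [set: 'I_(2 * r)]%SET c) => //.
- exact: (vtx k0 0).
- exact: tight_edge_inj.
- by apply/finset.setP => e; apply/imsetP/imsetP => -[i _ ->]; exists i.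
- by move=> S _ S0 dS u; apply: (tight_degree_ge2 k0).
- by under eq_bigl do rewrite finset.subsetT andTb.
Qed.

Theorem theorem1p5 (R : realType) :
  (forall (k : nat) (k_ge4 : (4 <= k)%N),
     ~ sidorenko R (tight_cycle (r := 3) (l := k) k_ge4)) /\
  (forall (k : nat) (k_ge7 : (7 <= k)%N),
     let C := tight_cycle (r := 3) (l := k) (leq_trans (isT : (4 <= 7)%N) k_ge7) in
     forall e : {set vertices C}, e \in edges C ->
       ~ sidorenko R (delete_edge e)) /\
  (forall (r : nat) (r_ge3 : (3 <= r)%N), odd r ->
     ~ sidorenko R (tight_cycle (ltn_mul2 r_ge3))).
Proof.
split; first exact: triple_cycle_not_sidorenko.
split=> [k k_ge7 C e eC|r r_ge3 _]; last exact: tight_cycle_double_not_sidorenko.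
exact: triple_cycle_minus_edge_not_sidorenko.
Qed.
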